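(* Let $\mathcal Y^1,\mathcal Y^2$ be complex Hilbert spaces, let $N\colon\mathcal Y^2\to\mathcal Y^2$ be a bounded nilpotent operator, let $A_1\colon\mathcal D(A_1)\subseteq\mathcal Y^1\to\mathcal Y^1$ be a closed and densely defined linear operator, and let $$(E,A)=\left(\begin{bmatrix}I_{\mathcal Y^1}&0\\0&N\end{bmatrix},\begin{bmatrix}A_1&0\\0&I_{\mathcal Y^2}\end{bmatrix}\right)$$ on $\mathcal Y^1\oplus\mathcal Y^2$, with $\mathcal D(A)=\mathcal D(A_1)\oplus\mathcal Y^2$. Let $p\in\mathbb N$. Then: a) $(E,A)$ has radiality index $p$ if and only if $(I_{\mathcal Y^1},A_1)$ has radiality index $p$ and $N$ has nilpotency degree smaller than or equal to $p+1$. b) If $A_1$ generates a $C_0$-semigroup and $N$ has nilpotency degree smaller than or equal to $p+1$, then $(E,A)$ is $p$-radial and, in particular, has radiality index $p$.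
   Context: $\mathbb N=\{0,1,2,\dots\}$. For Hilbert spaces $\mathcal X,\mathcal Z$, $E\in L(\mathcal X,\mathcal Z)$ (bounded linear) and $A\colon\mathcal D(A)\subseteq\mathcal X\to\mathcal Z$ closed and densely defined, $\rho(E,A)=\{\lambda\in\mathbb C:(\lambda E-A)^{-1}\in L(\mathcal Z,\mathcal X)\}$. For $p\in\mathbb N$, $(E,A)$ has radiality index $p$ ($p=p_{\rm rad}^{(E,A)}$) if there exist $\omega,C>0$ such that $(\omega,\infty)\subseteq\rho(E,A)$ and $$\Big\|\big((\lambda_0E-A)^{-1}E\cdots(\lambda_pE-A)^{-1}E\big)^n\Big\|\le\frac{C}{\prod_{k=0}^p|\lambda_k-\omega|^n},\qquad \Big\|\big(E(\lambda_0E-A)^{-1}\cdots E(\lambda_pE-A)^{-1}\big)^n\Big\|\le\frac{C}{\prod_{k=0}^p|\lambda_k-\omega|^n}$$ holds for all $\lambda_0,\dots,\lambda_p\in(\omega,\infty)$ and $n=1$. (No minimality of $p$ is required.) $(E,A)$ is $p$-radial if it has radiality index $p$ and these estimates hold for all $n\in\mathbb N$ (with $\omega,C$ independent of $n$ and of the $\lambda_k$). *)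

(* Defs.v *)
From Stdlib Require Export Reals.
From Stdlib Require Import ClassicalEpsilon.
From Coquelicot Require Export Coquelicot.

Set Implicit Arguments.
Unset Strict Implicit.
Unset Printing Implicit Defensive.

Local Open Scope R_scope.

Record HilbertSpace : Type := {
  hilbert_space :> CompleteNormedModule C_AbsRing;
  inner : hilbert_space -> hilbert_space -> C;
  inner_plus : forall x y z : hilbert_space,
    inner (plus x y) z = Cplus (inner x z) (inner y z);
  inner_scal : forall (a : C) (x y : hilbert_space),
    inner (scal a x) y = Cmult a (inner x y);
  inner_conj : forall x y : hilbert_space, inner y x = Cconj (inner x y);
  inner_norm : forall x : hilbert_space, inner x x = RtoC (norm x ^ 2)
}.

Section DirectSum.

Variables X Y : CompleteNormedModule C_AbsRing.

Definition prod_lim (F : (X * Y -> Prop) -> Prop) : X * Y :=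
  (lim (filtermap fst F), lim (filtermap snd F)).

Lemma prod_lim_ball (F : (X * Y -> Prop) -> Prop) :
  ProperFilter F -> cauchy F ->
  forall eps : posreal, F (ball (prod_lim F) eps).
Proof.
intros FF HF eps.
assert (H1 : filtermap fst F (ball (lim (filtermap fst F)) eps)).
{ apply complete_cauchy.
  - now apply filtermap_proper_filter.
  - intros e; destruct (HF e) as [z Hz]; exists (fst z).
    unfold filtermap; eapply filter_imp; [|exact Hz]; now intros t [Ht _]. }
assert (H2 : filtermap snd F (ball (lim (filtermap snd F)) eps)).
{ apply complete_cauchy.
  - now apply filtermap_proper_filter.
  - intros e; destruct (HF e) as [z Hz]; exists (snd z).
    unfold filtermap; eapply filter_imp; [|exact Hz]; now intros t [_ Ht]. }
unfold filtermap in H1, H2.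
generalize (filter_and _ _ H1 H2); apply filter_imp.
now intros t [h1 h2]; split.
Qed.

Lemma prod_lim_close (F1 F2 : (X * Y -> Prop) -> Prop) :
  filter_le F1 F2 -> filter_le F2 F1 -> close (prod_lim F1) (prod_lim F2).
Proof.
intros H12 H21 eps; split.
- refine (close_lim (filtermap fst F1) (filtermap fst F2) _ _ eps);
    intros P HP; [now apply H12 | now apply H21].
- refine (close_lim (filtermap snd F1) (filtermap snd F2) _ _ eps);
    intros P HP; [now apply H12 | now apply H21].
Qed.

Definition prod_complete_mixin :=
  CompleteSpace.Mixin (prod_UniformSpace X Y) prod_lim
    prod_lim_ball prod_lim_close.

Definition prod_CompleteNormedModule : CompleteNormedModule C_AbsRing :=
  CompleteNormedModule.Pack C_AbsRing (X * Y)
    (CompleteNormedModule.Class C_AbsRing (X * Y)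
       (NormedModule.class _ (prod_NormedModule C_AbsRing X Y))
       prod_complete_mixin)
    (X * Y).

End DirectSum.

Section HilbertDirectSum.

Variables X Y : HilbertSpace.

Definition sum_inner (u v : prod_CompleteNormedModule X Y) : C :=
  Cplus (inner (fst u) (fst v)) (inner (snd u) (snd v)).

Lemma sum_inner_plus (u v w : prod_CompleteNormedModule X Y) :
  sum_inner (plus u v) w = Cplus (sum_inner u w) (sum_inner v w).
Proof. unfold sum_inner; simpl; rewrite !inner_plus; ring. Qed.

Lemma sum_inner_scal (a : C) (u v : prod_CompleteNormedModule X Y) :
  sum_inner (scal a u) v = Cmult a (sum_inner u v).
Proof. unfold sum_inner; simpl; rewrite !inner_scal; ring. Qed.

Lemma sum_inner_conj (u v : prod_CompleteNormedModule X Y) :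
  sum_inner v u = Cconj (sum_inner u v).
Proof.
unfold sum_inner.
rewrite (inner_conj (fst u)), (inner_conj (snd u)), Cplus_conj; reflexivity.
Qed.

Lemma sum_inner_norm (u : prod_CompleteNormedModule X Y) :
  sum_inner u u = RtoC (norm u ^ 2).
Proof.
unfold sum_inner; rewrite !inner_norm, <- RtoC_plus; f_equal.
change (norm u) with (sqrt (norm (fst u) ^ 2 + norm (snd u) ^ 2)).
rewrite pow2_sqrt; [reflexivity|].
now apply Rplus_le_le_0_compat; apply pow2_ge_0.
Qed.

(* Coquelicot's product norm is [sqrt (norm (fst u) ^ 2 + norm (snd u) ^ 2)],
   so the product carries the Hilbert-space norm of the orthogonal sum. *)
Definition hilbert_sum : HilbertSpace :=
  Build_HilbertSpace sum_inner_plus sum_inner_scal sum_inner_conj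
    sum_inner_norm.

End HilbertDirectSum.

(* [is_linear] is Coquelicot's predicate "linear and bounded". *)
Record BoundedOp (X Z : HilbertSpace) : Type := {
  bop :> X -> Z;
  bop_is_linear : is_linear bop
}.

Definition id_bop (X : HilbertSpace) : BoundedOp X X :=
  Build_BoundedOp (is_linear_id (V := X)).

Section DiagonalBounded.

Variables (X1 Z1 X2 Z2 : HilbertSpace).
Variables (B1 : BoundedOp X1 Z1) (B2 : BoundedOp X2 Z2).

Lemma diag_is_linear :
  is_linear (U := hilbert_sum X1 X2) (V := hilbert_sum Z1 Z2)
    (fun u => (B1 (fst u), B2 (snd u))).
Proof.
apply (is_linear_prod (T := prod_NormedModule C_AbsRing X1 X2)
         (U := Z1) (V := Z2)
         (fun u => B1 (fst u)) (fun u => B2 (snd u))).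
- apply (is_linear_comp (U := prod_NormedModule C_AbsRing X1 X2)
           (V := X1) (W := Z1) fst B1).
  + apply is_linear_fst.
  + apply bop_is_linear.
- apply (is_linear_comp (U := prod_NormedModule C_AbsRing X1 X2)
           (V := X2) (W := Z2) snd B2).
  + apply is_linear_snd.
  + apply bop_is_linear.
Qed.

Definition diag_bop : BoundedOp (hilbert_sum X1 X2) (hilbert_sum Z1 Z2) :=
  Build_BoundedOp diag_is_linear.

End DiagonalBounded.

(* The supremum is taken in [Rbar], so it is meaningful for any map. *)
Definition op_norm (X Z : HilbertSpace) (T : X -> Z) : Rbar :=
  Lub_Rbar (fun r : R => exists x : X, norm x <= 1 /\ r = norm (T x)).

Definition vanishing_power (X : HilbertSpace) (N : BoundedOp X X) (k : nat) :
  Prop := forall x : X, Nat.iter k N x = zero.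

Definition nilpotent (X : HilbertSpace) (N : BoundedOp X X) : Prop :=
  exists k : nat, vanishing_power N k.

Definition nilpotency_degree (X : HilbertSpace) (N : BoundedOp X X) (k : nat) :
  Prop :=
  vanishing_power N k /\ (forall j : nat, vanishing_power N j -> (k <= j)%nat).

Definition nilpotency_degree_le (X : HilbertSpace) (N : BoundedOp X X)
  (m : nat) : Prop :=
  exists k : nat, nilpotency_degree N k /\ (k <= m)%nat.

(* A linear operator defined on the subspace [dom]; [op] is a total function
   whose values outside [dom] are irrelevant. *)
Record LinOp (X Z : HilbertSpace) : Type := {
  dom : X -> Prop;
  op : X -> Z;
  dom_zero : dom zero;
  dom_plus : forall x y : X, dom x -> dom y -> dom (plus x y);
  dom_scal : forall (a : C) (x : X), dom x -> dom (scal a x);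
  op_plus : forall x y : X,
    dom x -> dom y -> op (plus x y) = plus (op x) (op y);
  op_scal : forall (a : C) (x : X), dom x -> op (scal a x) = scal a (op x)
}.

Definition closed_op (X Z : HilbertSpace) (A : LinOp X Z) : Prop :=
  closed (fun u : hilbert_sum X Z => dom A (fst u) /\ snd u = op A (fst u)).

Definition densely_defined (X Z : HilbertSpace) (A : LinOp X Z) : Prop :=
  forall (x : X) (eps : posreal),
  exists y : X, dom A y /\ norm (minus y x) < eps.

Definition linop_of_bop (X Z : HilbertSpace) (B : BoundedOp X Z) : LinOp X Z :=
  {| dom := fun _ : X => True;
     op := B;
     dom_zero := I;
     dom_plus := fun _ _ _ _ => I;
     dom_scal := fun _ _ _ => I;
     op_plus := fun x y _ _ => linear_plus _ (bop_is_linear B) x y;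
     op_scal := fun a x _ => linear_scal _ (bop_is_linear B) a x |}.

Section DiagonalUnbounded.

Variables (X1 Z1 X2 Z2 : HilbertSpace).
Variables (A1 : LinOp X1 Z1) (A2 : LinOp X2 Z2).

Definition diag_dom (u : hilbert_sum X1 X2) : Prop :=
  dom A1 (fst u) /\ dom A2 (snd u).

Definition diag_fun (u : hilbert_sum X1 X2) : hilbert_sum Z1 Z2 :=
  (op A1 (fst u), op A2 (snd u)).

Lemma diag_dom_zero : diag_dom zero.
Proof. split; apply dom_zero. Qed.

Lemma diag_dom_plus (u v : hilbert_sum X1 X2) :
  diag_dom u -> diag_dom v -> diag_dom (plus u v).
Proof. now intros [] []; split; apply dom_plus. Qed.

Lemma diag_dom_scal (a : C) (u : hilbert_sum X1 X2) :
  diag_dom u -> diag_dom (scal a u).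
Proof. now intros []; split; apply dom_scal. Qed.

Lemma diag_fun_plus (u v : hilbert_sum X1 X2) :
  diag_dom u -> diag_dom v ->
  diag_fun (plus u v) = plus (diag_fun u) (diag_fun v).
Proof.
intros [] []; unfold diag_fun; simpl; rewrite !op_plus by assumption.
reflexivity.
Qed.

Lemma diag_fun_scal (a : C) (u : hilbert_sum X1 X2) :
  diag_dom u -> diag_fun (scal a u) = scal a (diag_fun u).
Proof.
intros []; unfold diag_fun; simpl; rewrite !op_scal by assumption.
reflexivity.
Qed.

Definition diag_op : LinOp (hilbert_sum X1 X2) (hilbert_sum Z1 Z2) :=
  Build_LinOp diag_dom_zero diag_dom_plus diag_dom_scal
    diag_fun_plus diag_fun_scal.

End DiagonalUnbounded.

Section Pencil.

Variables X Z : HilbertSpace.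
Variables (E : BoundedOp X Z) (A : LinOp X Z).

Definition pencil (l : C) (x : X) : Z := minus (scal l (E x)) (op A x).

(* [S] is bounded and a two-sided inverse of [lambda E - A : D(A) -> Z]. *)
Definition is_resolvent (l : C) (S : Z -> X) : Prop :=
  is_linear S /\
  (forall z : Z, dom A (S z) /\ pencil l (S z) = z) /\
  (forall x : X, dom A x -> S (pencil l x) = x).

Definition resolvent_set (l : C) : Prop :=
  exists S : Z -> X, is_resolvent l S.

(* Unspecified when [l] is not in the resolvent set. *)
Definition resolvent (l : C) : Z -> X :=
  epsilon (inhabits (fun _ : Z => zero)) (is_resolvent l).

Definition right_resolvent (l : R) (x : X) : X := resolvent (RtoC l) (E x).

Definition left_resolvent (l : R) (z : Z) : Z := E (resolvent (RtoC l) z).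

(* [op_prod T k] is the composition of [T 0], [T 1], ..., [T (k - 1)], in this
   order from left to right. *)
Fixpoint op_prod (V : Type) (T : nat -> V -> V) (k : nat) (v : V) : V :=
  match k with
  | O => v
  | S k' => op_prod T k' (T k' v)
  end.

Definition radial_estimates (p : nat) (omega K : R) (n : nat) : Prop :=
  forall lam : nat -> R,
    (forall k : nat, (k <= p)%nat -> omega < lam k) ->
    let bound := K / prod_f_R0 (fun k => Rabs (lam k - omega) ^ n) p in
    Rbar_le
      (op_norm
         (Nat.iter n (op_prod (fun k => right_resolvent (lam k)) (p + 1))))
      bound /\
    Rbar_le
      (op_norm
         (Nat.iter n (op_prod (fun k => left_resolvent (lam k)) (p + 1))))
      bound.

Definition ray_in_resolvent_set (omega : R) : Prop :=
  forall l : R, omega < l -> resolvent_set (RtoC l).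

Definition has_radiality_index (p : nat) : Prop :=
  exists omega K : R,
    0 < omega /\ 0 < K /\ ray_in_resolvent_set omega /\
    radial_estimates p omega K 1.

Definition p_radial (p : nat) : Prop :=
  has_radiality_index p /\
  exists omega K : R,
    0 < omega /\ 0 < K /\ ray_in_resolvent_set omega /\
    forall n : nat, radial_estimates p omega K n.

End Pencil.

(* Only the values [T t] with [0 <= t] matter. *)
Definition C0_semigroup (X : HilbertSpace) (T : R -> X -> X) : Prop :=
  (forall t : R, 0 <= t -> is_linear (T t)) /\
  (forall x : X, T 0 x = x) /\
  (forall (s t : R) (x : X), 0 <= s -> 0 <= t -> T (s + t) x = T s (T t x)) /\
  (forall x : X, filterlim (fun t => T t x) (at_right 0) (locally x)).

Definition is_generator (X : HilbertSpace) (A : LinOp X X) (T : R -> X -> X) :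
  Prop :=
  forall x y : X,
    (dom A x /\ op A x = y) <->
    filterlim (fun h => scal (RtoC (/ h)) (minus (T h x) x))
      (at_right 0) (locally y).

Definition generates_C0_semigroup (X : HilbertSpace) (A : LinOp X X) : Prop :=
  exists T : R -> X -> X, C0_semigroup T /\ is_generator A T.

(* Main.v *)
From Stdlib Require Import Lra Lia ClassicalEpsilon Wf_nat Classical.
Require Import Defs.

(* The pencil is block diagonal, so its resolvents and their products are taken
   block by block. On the second block [T = (l N - I)^-1 N] commutes with [N] and
   maps [ker N^(j+1)] into [ker N^j]: if [N^(p+1) = 0], every product of [p + 1]
   such factors vanishes; conversely, on [ker N^(p+2)] the product is
   [(-1)^(p+1) N^(p+1)] for all values of [l], and letting [l] tend to infinity
   in the radiality estimate gives [ker N^(p+2) = ker N^(p+1)].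

   For a generator, renorming by [sup_t exp (- w t) |T t x|] reduces the power
   estimates to [|(l - A)^-1| <= 1 / (l - w)]. The resolvent is obtained without
   integrals: [B h = (exp (l h) - T h) / h] is invertible with inverse bounded by
   [1 / (l - w)] and tends to [l - A] on the domain of [A]; since
   [B h^-1 - B g^-1 = B h^-1 B g^-1 (B g - B h)], the inverses converge strongly
   as [h] tends to [0]. *)

Local Open Scope R_scope.

(** * Linear identities by [ring] *)

(** A bound [M / (l - w)] for each resolvent would leave powers of [M] in front of a product. In the
    orbit norm the constant is 1 and survives multiplication, so [M] is paid once, on return to the
    original norm. The growth bound behind that norm needs uniform boundedness, because strong
    continuity gives only pointwise bounds near time 0. Density of the domain carries convergence of
    the inverses to the whole space; closedness of the generator keeps the values of the limit in
    the domain.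

    On the nilpotent block, (l N - I)^-1 is a polynomial in l, so a product of resolvents depends on
    every [lam k] and its limit cannot be read off directly. On ker N^(p+2) only the lowest power of
    N in the product survives. Two equal consecutive kernels make the chain of kernels stationary,
    and nilpotency forces the stationary value to be the whole space. *)

Section DualNumbers.

Variables (V : Type) (add : V -> V -> V) (opp : V -> V) (o : V) (scal : C -> V -> V).

Definition dual : Type := (C * V)%type.
Definition dual_zero : dual := (RtoC 0, o).
Definition dual_one : dual := (RtoC 1, o).
Definition dual_add (u v : dual) : dual := (Cplus (fst u) (fst v), add (snd u) (snd v)).
Definition dual_opp (u : dual) : dual := (Copp (fst u), opp (snd u)).
Definition dual_sub (u v : dual) : dual := dual_add u (dual_opp v).
Definition dual_mul (u v : dual) : dual :=
  (Cmult (fst u) (fst v), add (scal (fst u) (snd v)) (scal (fst v) (snd u))).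

Hypothesis addA : forall x y z, add x (add y z) = add (add x y) z.
Hypothesis addC : forall x y, add x y = add y x.
Hypothesis add0 : forall x, add o x = x.
Hypothesis addN : forall x, add x (opp x) = o.
Hypothesis scalD : forall a x y, scal a (add x y) = add (scal a x) (scal a y).
Hypothesis scalP : forall a b x, scal (Cplus a b) x = add (scal a x) (scal b x).
Hypothesis scalM : forall a b x, scal (Cmult a b) x = scal a (scal b x).
Hypothesis scal1 : forall x, scal (RtoC 1) x = x.
Hypothesis scal0 : forall a, scal a o = o.

(* Scalars [(a, 0)] and vectors [(0, x)] live together in the commutative ring
   [C * V] with [V * V = 0], so that [ring] decides linear identities in [V]. *)
Lemma dual_ring :
  ring_theory dual_zero dual_one dual_add dual_mul dual_sub dual_opp eq.
Proof.
assert (scalC : forall a b x, scal a (scal b x) = scal b (scal a x)).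
{ intros a b x; rewrite <- !scalM; f_equal; ring. }
split; intros; repeat match goal with u : dual |- _ => destruct u end;
  unfold dual_sub, dual_opp, dual_mul, dual_add, dual_zero, dual_one; simpl;
  apply f_equal2; try ring.
- apply add0.
- apply addC.
- apply addA.
- now rewrite scal0, scal1, addC, add0.
- apply addC.
- rewrite !scalD, !scalM, <- addA; f_equal.
  f_equal; apply scalC.
- rewrite scalP, scalD, <- !addA; f_equal.
  rewrite !addA; f_equal; apply addC.
- reflexivity.
- apply addN.
Qed.

End DualNumbers.

Section Vectors.

Variable X : HilbertSpace.

Let V := CompleteNormedModule.ModuleSpace C_AbsRing X.

Implicit Types (x y z : X) (a b : C).

Definition vector_ring :=
  dual_ring X plus opp zero scal
    (plus_assoc (G := V)) (plus_comm (G := V)) (plus_zero_l (G := V))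
    (plus_opp_r (G := V)) (scal_distr_l (V := V)) (scal_distr_r (V := V))
    (fun a b x => eq_sym (scal_assoc (V := V) a b x))
    (scal_one (V := V)) (scal_zero_r (V := V)).

Definition vec x : dual X := (RtoC 0, x).
Definition sca a : dual X := (a, zero).
Notation dadd := (dual_add X plus).
Notation dopp := (dual_opp X opp).
Notation dsub := (dual_sub X plus opp).
Notation dmul := (dual_mul X plus scal).
Notation d0 := (dual_zero X zero).
Notation d1 := (dual_one X zero).

Lemma vec_inj x y : vec x = vec y -> x = y.
Proof. now intros [= H]. Qed.

Lemma vec_plus x y : vec (plus x y) = dadd (vec x) (vec y).
Proof. unfold vec, dual_add; simpl; f_equal; ring. Qed.

Lemma vec_opp x : vec (opp x) = dopp (vec x).
Proof. unfold vec, dual_opp; simpl; f_equal; ring. Qed.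

Lemma vec_minus x y : vec (minus x y) = dsub (vec x) (vec y).
Proof. unfold minus, dual_sub; now rewrite vec_plus, vec_opp. Qed.

Lemma vec_zero : vec zero = d0.
Proof. reflexivity. Qed.

Lemma vec_scal a x : vec (scal a x) = dmul (sca a) (vec x).
Proof.
unfold vec, sca, dual_mul; simpl; f_equal; [ring|].
rewrite (scal_zero_r (V := V)); symmetry; apply (plus_zero_r (G := V)).
Qed.

Lemma sca_plus a b : sca (Cplus a b) = dadd (sca a) (sca b).
Proof.
unfold sca, dual_add; simpl; f_equal; symmetry; apply (plus_zero_r (G := V)).
Qed.

Lemma sca_opp a : sca (Copp a) = dopp (sca a).
Proof.
unfold sca, dual_opp; simpl; f_equal; symmetry; apply (opp_zero (G := V)).
Qed.

Lemma sca_mult a b : sca (Cmult a b) = dmul (sca a) (sca b).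
Proof.
unfold sca, dual_mul; simpl; f_equal.
rewrite !(scal_zero_r (V := V)); symmetry; apply (plus_zero_r (G := V)).
Qed.

Lemma sca_one : sca (RtoC 1) = d1.
Proof. reflexivity. Qed.

Lemma sca_zero : sca (RtoC 0) = d0.
Proof. reflexivity. Qed.

End Vectors.

(** [vec] is injective and turns module operations into ring operations on dual numbers; the section
    that calls this must have registered [vector_ring] of its space. *)
Ltac vector X :=
  intros; apply (vec_inj X); unfold Rminus, Cminus;
  repeat first
    [ rewrite vec_plus | rewrite vec_opp | rewrite vec_minus | rewrite vec_zero
    | rewrite vec_scal | rewrite RtoC_plus | rewrite RtoC_opp
    | rewrite RtoC_mult | rewrite sca_plus | rewrite sca_opp
    | rewrite sca_mult | rewrite sca_one | rewrite sca_zero ];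
  ring.

(** * Limits and uniform boundedness *)

Section NormedSpace.

Variable X : HilbertSpace.

Add Ring hilbert_vector_ring : (vector_ring X).

Implicit Types (x y z : X).

Local Notation W := (CompleteNormedModule.NormedModule C_AbsRing X).

Lemma norm_zero_vector : norm (zero : X) = 0.
Proof. exact (norm_zero (V := W)). Qed.

Lemma norm_real_scal_le (a : R) x : norm (scal (RtoC a) x) <= Rabs a * norm x.
Proof. rewrite <- Cmod_R; apply (norm_scal (RtoC a) x). Qed.

Lemma real_scal_inv (a : R) x : a <> 0 -> scal (RtoC a) (scal (RtoC (/ a)) x) = x.
Proof.
intros Ha; transitivity (scal (RtoC (a * / a)) x).
- vector X.
- rewrite Rinv_r by exact Ha; vector X.
Qed.

(** A normed module asserts only the inequality; the converse is that inequality for the inverse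
    scalar. *)
Lemma norm_real_scal (a : R) x : norm (scal (RtoC a) x) = Rabs a * norm x.
Proof.
apply Rle_antisym; [apply norm_real_scal_le|].
destruct (Req_dec a 0) as [->|Ha].
- rewrite Rabs_R0, Rmult_0_l; apply (norm_ge_0 (V := W)).
- assert (H := norm_real_scal_le (/ a) (scal (RtoC a) x)).
  replace (scal (RtoC (/ a)) (scal (RtoC a) x)) with x in H.
  + rewrite Rabs_inv in H.
    assert (P := Rabs_pos_lt _ Ha).
    apply Rmult_le_compat_l with (r := Rabs a) in H; [|lra].
    rewrite <- Rmult_assoc, Rinv_r, Rmult_1_l in H; lra.
  + rewrite <- (real_scal_inv a x Ha) at 1; vector X.
Qed.

Lemma norm_sub_sym x y : norm (minus x y) = norm (minus y x).
Proof.
rewrite <- (norm_opp (V := W) (minus y x)); f_equal; vector X.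
Qed.

Lemma norm_sub_triangle y x z : norm (minus x z) <= norm (minus x y) + norm (minus y z).
Proof.
replace (minus x z) with (plus (minus x y) (minus y z)) by vector X.
apply (norm_triangle (V := W)).
Qed.

Lemma norm_le_sub x y : norm x <= norm (minus x y) + norm y.
Proof.
replace x with (plus (minus x y) y) at 1 by vector X; apply (norm_triangle (V := W)).
Qed.

Lemma lim_norm {T : Type} {F : (T -> Prop) -> Prop} {FF : Filter F} (f : T -> X) x :
  filterlim f F (locally x) <->
  forall eps : R, 0 < eps -> F (fun t => norm (minus (f t) x) < eps).
Proof.
rewrite (filterlim_locally_ball_norm f x); split; intros H.
- intros eps He; exact (H (mkposreal eps He)).
- intros eps; exact (H eps (cond_pos eps)).
Qed.

Lemma lim_unique {T : Type} {F : (T -> Prop) -> Prop} {FF : ProperFilter F}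
  (f : T -> X) x y :
  filterlim f F (locally x) -> filterlim f F (locally y) -> x = y.
Proof.
apply (filterlim_locally_unique (V := W) f).
Qed.

Lemma norm_lim_le {T : Type} {F : (T -> Prop) -> Prop} {FF : ProperFilter F}
  (f : T -> X) x b :
  filterlim f F (locally x) -> F (fun t => norm (f t) <= b) -> norm x <= b.
Proof.
intros Hf Hb; apply Rnot_lt_le; intros Hlt.
rewrite lim_norm in Hf.
assert (He : 0 < norm x - b) by lra.
destruct (filter_ex _ (filter_and _ _ (Hf _ He) Hb)) as [t [H1 H2]].
rewrite norm_sub_sym in H1.
assert (H := norm_le_sub x (f t)); lra.
Qed.

Lemma lim_linear {T : Type} {F : (T -> Prop) -> Prop} {FF : Filter F}
  (L : X -> X) (f : T -> X) x :
  is_linear L -> filterlim f F (locally x) ->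
  filterlim (fun t => L (f t)) F (locally (L x)).
Proof.
intros HL Hf; apply filterlim_comp with (1 := Hf).
exact (linear_cont L x HL).
Qed.

Lemma lim_plus {T : Type} {F : (T -> Prop) -> Prop} {FF : Filter F}
  (f g : T -> X) x y :
  filterlim f F (locally x) -> filterlim g F (locally y) ->
  filterlim (fun t => plus (f t) (g t)) F (locally (plus x y)).
Proof.
intros Hf Hg.
exact (filterlim_comp_2 f g plus Hf Hg
  (filterlim_plus (V := W) x y)).
Qed.

Lemma lim_scal {T : Type} {F : (T -> Prop) -> Prop} {FF : Filter F}
  (a : C) (f : T -> X) x :
  filterlim f F (locally x) ->
  filterlim (fun t => scal a (f t)) F (locally (scal a x)).
Proof.
intros Hf; apply filterlim_comp with (1 := Hf).
exact (filterlim_scal_r (V := W) a x).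
Qed.

Lemma linear_sub (L : X -> X) x y : is_linear L -> L (minus x y) = minus (L x) (L y).
Proof.
intros HL; transitivity (plus (L x) (L (scal (Copp (RtoC 1)) y))).
- rewrite <- (linear_plus _ HL); f_equal; vector X.
- rewrite (linear_scal _ HL); vector X.
Qed.

Lemma cauchy_lim {T : Type} {F : (T -> Prop) -> Prop} {FF : ProperFilter F}
  (f : T -> X) :
  (forall eps : R, 0 < eps -> exists P, F P /\
     forall s t, P s -> P t -> norm (minus (f s) (f t)) < eps) ->
  exists x, filterlim f F (locally x).
Proof.
intros H; apply (filterlim_locally_cauchy f); intros eps.
destruct (H eps (cond_pos eps)) as [P [HP HC]]; exists P; split; [exact HP|].
intros s t Hs Ht.
apply (norm_compat1 (V := W)).
now apply HC.
Qed.

Lemma seq_cauchy_lim (u : nat -> X) (e : nat -> R) :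
  is_lim_seq e 0 ->
  (forall n m, (n <= m)%nat -> norm (minus (u m) (u n)) <= e n) ->
  exists x, filterlim u eventually (locally x).
Proof.
intros He Hu; apply cauchy_lim; intros eps Heps.
apply is_lim_seq_spec in He.
assert (Heps' : 0 < eps / 2) by lra.
destruct (He (mkposreal _ Heps')) as [n Hn].
exists (fun m => (n <= m)%nat); split; [now exists n|].
intros s t Hs Ht.
specialize (Hn n (le_n n)); simpl in Hn; rewrite Rminus_0_r in Hn.
apply Rabs_def2 in Hn.
assert (H1 := Hu n s Hs); assert (H2 := Hu n t Ht).
assert (H3 := norm_sub_triangle (u n) (u s) (u t)).
rewrite (norm_sub_sym (u n)) in H3; lra.
Qed.

(** Since 2 L v = L (x + v) - L (x - v), one of x + v and x - v has an image at least as long as L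
    v. So any ball around x sees the growth of L, wherever its centre lies. *)
Lemma linear_grows (L : X -> X) x v :
  is_linear L ->
  exists x', norm (minus x' x) <= norm v /\ norm (L v) <= norm (L x').
Proof.
intros HL.
destruct (Rle_lt_dec (norm (L v)) (norm (L (plus x v)))) as [H|H].
- exists (plus x v); split; [|exact H].
  right; f_equal; vector X.
- exists (minus x v); split.
  + right; rewrite <- (norm_opp (V := W) v); f_equal; vector X.
  + assert (E : L (plus x v) = plus (L x) (L v)) by apply (linear_plus _ HL).
    assert (E' := linear_sub L x v HL).
    assert (E2 : norm (scal (RtoC 2) (L v)) <= norm (L (plus x v)) + norm (L (minus x v))).
    { rewrite <- (norm_opp (V := W) (L (minus x v))), E, E'.
      replace (scal (RtoC 2) (L v)) with
        (plus (plus (L x) (L v)) (opp (minus (L x) (L v)))); [apply (norm_triangle (V := W))|].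
      replace 2 with (1 + 1) by ring; vector X. }
    rewrite norm_real_scal, Rabs_pos_eq in E2; lra.
Qed.

(** A gliding hump in place of Baire's theorem: if no uniform bound exists, there are nested balls
    such that on the n-th one some [L i] has norm at least n. The limit of the centres then violates
    the pointwise bound. *)
Lemma uniform_boundedness (I : Type) (L : I -> X -> X) :
  (forall i, is_linear (L i)) ->
  (forall x, exists b, forall i, norm (L i x) <= b) ->
  exists M, forall i x, norm (L i x) <= M * norm x.
Proof.
intros HL Hpt; apply NNPP; intros Hno.
assert (Hbig : forall M, exists i u, M * norm u < norm (L i u)).
{ intros M; apply NNPP; intros H; apply Hno; exists M; intros i x.
  apply Rnot_lt_le; intros H'; apply H; now exists i, x. }
(* Pairs are balls (centre, radius); the two halves of the radius place ball [q] inside ball [p]. *)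
pose (P := fun k (p q : X * R) =>
  0 < snd q <= snd p / 2 /\ norm (minus (fst q) (fst p)) <= snd p / 2 /\
  exists i, forall y, norm (minus y (fst q)) <= snd q -> k <= norm (L i y)).
assert (Hstep : forall k p, 0 < snd p -> 0 <= k -> exists q, P k p q).
{ intros k [x r] Hr Hk; simpl in Hr.
  (* Once [u] is rescaled to length r / 2, this constant makes its image longer than k + 1. *)
  destruct (Hbig (2 * (k + 1) / r)) as [i [u Hu]].
  assert (Hc : 0 < 2 * (k + 1) / r).
  { apply Rdiv_lt_0_compat; lra. }
  assert (Hu0 : 0 < norm u).
  { destruct (norm_ge_0 (V := W) u) as [H|H]; [exact H|exfalso].
    destruct (linear_norm _ (HL i)) as [m [_ Hm]].
    specialize (Hm u).
    change (norm (L i u) <= m * norm u) in Hm.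
    rewrite <- H in Hm, Hu; lra. }
  pose (a := r / (2 * norm u)).
  assert (Ha : 0 < a) by (apply Rdiv_lt_0_compat; lra).
  destruct (linear_grows (L i) x (scal (RtoC a) u) (HL i)) as [x' [Hx' HLx']].
  rewrite norm_real_scal, Rabs_pos_eq in Hx' by lra.
  replace (a * norm u) with (r / 2) in Hx' by (unfold a; field; lra).
  rewrite (linear_scal _ (HL i)) in HLx'.
  change (norm (scal (RtoC a) (L i u)) <= norm (L i x')) in HLx'.
  rewrite norm_real_scal, Rabs_pos_eq in HLx' by lra.
  assert (Hk1 : k + 1 <= norm (L i x')).
  { apply Rle_trans with (2 := HLx').
    apply Rmult_lt_compat_l with (r := a) in Hu; [|exact Ha].
    replace (a * (2 * (k + 1) / r * norm u)) with (k + 1) in Hu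
      by (unfold a; field; lra).
    lra. }
  destruct (linear_norm _ (HL i)) as [m [Hm0 Hm]].
  (* Within distance 1 / m of [x'] the norm of [L i] drops by at most 1, from k + 1 to k. *)
  exists (x', Rmin (r / 2) (/ m)); unfold P; simpl.
  assert (Hm' := Rinv_0_lt_compat _ Hm0).
  repeat split.
  - apply Rmin_pos; lra.
  - apply Rmin_l.
  - exact Hx'.
  - exists i; intros y Hy.
    assert (H1 := norm_le_sub (L i x') (L i y)).
    rewrite <- (linear_sub _ _ _ (HL i)), (linear_sub _ _ _ (HL i)), norm_sub_sym,
      <- (linear_sub _ _ _ (HL i)) in H1.
    assert (H2 := Hm (minus y x')).
    change (norm (L i (minus y x')) <= m * norm (minus y x')) in H2.
    assert (H3 := Rmin_r (r / 2) (/ m)).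
    assert (H4 : m * norm (minus y x') <= m * / m).
    { apply Rmult_le_compat_l; lra. }
    rewrite Rinv_r in H4; lra. }
pose (s := fix s n : X * R := match n with
  | O => (zero, 1)
  | S n' => epsilon (inhabits (s n')) (P (INR n') (s n')) end).
assert (Hs0 : forall n, 0 < snd (s n)).
{ induction n as [|n IH]; [simpl; lra|].
  apply (epsilon_spec (inhabits (s n)) _ (Hstep (INR n) (s n) IH (pos_INR n))). }
assert (Hs : forall n, P (INR n) (s n) (s (S n))).
{ intros n; apply (epsilon_spec (inhabits (s n)) _
    (Hstep (INR n) (s n) (Hs0 n) (pos_INR n))). }
assert (Hr : forall n, snd (s n) <= (/ 2) ^ n).
{ induction n as [|n IH]; [simpl; lra|].
  destruct (Hs n) as [H _]. change ((/ 2) ^ S n) with (/ 2 * (/ 2) ^ n); lra. }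
(* Each move is at most half the radius, hence at most the decrease of the radius, and these
   decreases telescope. *)
assert (Hd : forall n m, (n <= m)%nat ->
  norm (minus (fst (s m)) (fst (s n))) <= snd (s n) - snd (s m)).
{ intros n m Hnm; induction Hnm as [|m Hnm IH].
  - replace (minus (fst (s n)) (fst (s n))) with (zero : X) by vector X.
    rewrite norm_zero_vector; lra.
  - destruct (Hs m) as [H1 [H2 _]].
    assert (H3 := norm_sub_triangle (fst (s m)) (fst (s (S m))) (fst (s n))); lra. }
destruct (seq_cauchy_lim (fun n => fst (s n)) (fun n => snd (s n))) as [x Hx].
- apply is_lim_seq_le_le with (fun _ => 0) (fun n => (/ 2) ^ n).
  + intros n; split; [left; apply Hs0|apply Hr].
  + apply is_lim_seq_const.
  + apply is_lim_seq_geom; rewrite Rabs_pos_eq; lra.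
- intros n m Hnm; generalize (Hd n m Hnm) (Hs0 m); lra.
- destruct (Hpt x) as [b Hb].
  destruct (INR_unbounded b) as [n Hn].
  destruct (Hs n) as [_ [_ [i Hi]]].
  assert (H : norm (minus x (fst (s (S n)))) <= snd (s (S n))).
  { apply (norm_lim_le (F := eventually) (fun m => minus (fst (s m)) (fst (s (S n))))).
    - apply lim_plus; [exact Hx|apply filterlim_const].
    - exists (S n); intros m Hm; generalize (Hd _ _ Hm) (Hs0 m); lra. }
  generalize (Hi x H) (Hb i); lra.
Qed.

End NormedSpace.

(** * Resolvents of generators *)

Lemma finite_max (a : nat -> R) (n : nat) :
  exists b, forall k, (k < n)%nat -> a k <= b.
Proof.
induction n as [|n [b Hb]].
- exists 0; intros; lia.
- exists (Rmax b (a n)); intros k Hk.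
  destruct (Nat.eq_dec k n) as [->|Hne]; [apply Rmax_r|].
  apply Rle_trans with b; [apply Hb; lia|apply Rmax_l].
Qed.

Lemma le_of_geometric (a b c q : R) :
  0 <= q < 1 -> (forall n, a <= b + q ^ n * c) -> a <= b.
Proof.
intros Hq H.
apply (is_lim_seq_le (fun _ => a) (fun n => b + q ^ n * c) a b H).
- apply is_lim_seq_const.
- replace b with (b + 0 * c) at 1 by ring.
  apply is_lim_seq_plus'; [apply is_lim_seq_const|].
  apply is_lim_seq_mult'; [|apply is_lim_seq_const].
  apply is_lim_seq_geom; rewrite Rabs_pos_eq; lra.
Qed.

Lemma at_right_positive : at_right 0 (fun h => 0 < h).
Proof. now exists (mkposreal 1 Rlt_0_1). Qed.

Lemma exp_difference_quotient (l : R) :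
  filterlim (fun h => (exp (l * h) - 1) / h) (at_right 0) (locally l).
Proof.
assert (H : is_derive (fun h => exp (l * h)) 0 l).
{ auto_derive; [exact I|]; rewrite Rmult_0_r, exp_0; ring. }
apply is_derive_Reals in H.
apply filterlim_locally; intros eps.
destruct (H eps (cond_pos eps)) as [d Hd].
exists d; intros h Hh Hpos.
assert (Hh' : Rabs h < d).
{ change (Rabs (h - 0) < d) in Hh; now rewrite Rminus_0_r in Hh. }
specialize (Hd h (Rgt_not_eq _ _ Hpos) Hh').
rewrite Rplus_0_l, Rmult_0_r, exp_0 in Hd; exact Hd.
Qed.

(** * Exponential growth of a C_0-semigroup *)

Section Semigroup.

Variables (X : HilbertSpace) (T : R -> X -> X).
Hypothesis HT : C0_semigroup T.

Add Ring hilbert_vector_ring : (vector_ring X).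
Local Notation W := (CompleteNormedModule.NormedModule C_AbsRing X).

Implicit Types (x y z u v : X).

Let T_linear t : 0 <= t -> is_linear (T t).
Proof. apply (proj1 HT). Qed.

Let T0 x : T 0 x = x.
Proof. apply (proj1 (proj2 HT)). Qed.

Let T_add s t x : 0 <= s -> 0 <= t -> T (s + t) x = T s (T t x).
Proof. apply (proj1 (proj2 (proj2 HT))). Qed.

(** Otherwise there are times t_n at most 1 / (n + 1) at which T t_n stretches some vector by more
    than n + 1. Strong continuity at 0 bounds these operators pointwise, against uniform
    boundedness. *)
Lemma semigroup_bounded_near_0 :
  exists d M, 0 < d /\ 1 <= M /\
    forall t x, 0 <= t <= d -> norm (T t x) <= M * norm x.
Proof.
apply NNPP; intros Hno.
pose (P := fun n (p : R * X) =>
  0 <= fst p <= / (INR n + 1) /\ (INR n + 1) * norm (snd p) < norm (T (fst p) (snd p))).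
assert (HP : forall n, exists p, P n p).
{ intros n; apply NNPP; intros H; apply Hno.
  assert (Hn := pos_INR n).
  exists (/ (INR n + 1)), (INR n + 1); repeat split.
  - apply Rinv_0_lt_compat; lra.
  - lra.
  - intros t x Ht; apply Rnot_lt_le; intros H'; apply H; now exists (t, x). }
pose (s := fun n => epsilon (inhabits (0, zero) : inhabited (R * X)) (P n)).
assert (Hs : forall n, P n (s n)) by (intros n; apply epsilon_spec, HP).
destruct (uniform_boundedness X nat (fun n => T (fst (s n)))) as [M HM].
- intros n; apply T_linear, (Hs n).
- intros x.
  assert (Hx := proj1 (lim_norm X (F := at_right 0) _ x) (proj2 (proj2 (proj2 HT)) x)).
  destruct (Hx 1 Rlt_0_1) as [d Hd].
  destruct (INR_unbounded (/ d)) as [n0 Hn0].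
  destruct (finite_max (fun n => norm (T (fst (s n)) x)) n0) as [b Hb].
  exists (Rmax b (norm x + 1)); intros n.
  destruct (Nat.lt_ge_cases n n0) as [Hn|Hn].
  + apply Rle_trans with b; [now apply Hb|apply Rmax_l].
  + apply Rle_trans with (norm x + 1); [|apply Rmax_r].
    (* [at_right 0] says nothing about time 0 itself, where the operator is the identity. *)
    destruct (Hs n) as [[[H1|H1] H2] _].
    * assert (H3 : norm (minus (T (fst (s n)) x) x) < 1).
      { apply Hd; [|exact H1].
        change (Rabs (fst (s n) - 0) < d); rewrite Rminus_0_r, Rabs_pos_eq by lra.
        apply Rle_lt_trans with (1 := H2).
        apply le_INR in Hn.
        assert (Hd0 := cond_pos d).
        rewrite <- (Rinv_inv d); apply Rinv_lt_contravar; [|lra].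
        apply Rmult_lt_0_compat; [now apply Rinv_0_lt_compat|].
        assert (H := Rinv_0_lt_compat _ Hd0); lra. }
      assert (H4 := norm_le_sub X (T (fst (s n)) x) x); lra.
    * rewrite <- H1, T0; lra.
- destruct (INR_unbounded M) as [n Hn].
  destruct (Hs n) as [_ H].
  specialize (HM n (snd (s n))).
  assert (H0 := norm_ge_0 (V := W) (snd (s n))).
  assert (M * norm (snd (s n)) <= (INR n + 1) * norm (snd (s n))).
  { apply Rmult_le_compat_r; lra. }
  lra.
Qed.

(** Time is cut into steps of length [d]; each full step costs a factor [M], at most [exp (w * d)],
    and the remainder costs one more [M]. *)
Lemma semigroup_exponential_bound :
  exists w M, 0 < w /\ 1 <= M /\
    forall t x, 0 <= t -> norm (T t x) <= M * exp (w * t) * norm x.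
Proof.
destruct semigroup_bounded_near_0 as [d [M [Hd [HM HdM]]]].
(* The exponent [ln M / d] already matches [M] after time [d]; the added 1 makes [w] positive even
   when [M = 1]. *)
pose (w := ln M / d + 1).
assert (Hln : 0 <= ln M).
{ destruct HM as [H| <-]; [|rewrite ln_1; lra].
  rewrite <- ln_1; left; apply ln_increasing; lra. }
assert (Hw : 0 < w).
{ assert (0 <= ln M / d); [|unfold w; lra].
  apply Rmult_le_pos; [exact Hln|left; now apply Rinv_0_lt_compat]. }
assert (HMw : M <= exp (w * d)).
{ replace (w * d) with (ln M + d) by (unfold w; field; lra).
  rewrite exp_plus, exp_ln by lra.
  rewrite <- (Rmult_1_r M) at 1; apply Rmult_le_compat_l; [lra|].
  rewrite <- exp_0; left; apply exp_increasing; lra. }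
assert (H : forall n t x, 0 <= t <= INR n * d -> norm (T t x) <= M * exp (w * t) * norm x).
{ assert (Hsmall : forall t x, 0 <= t <= d -> norm (T t x) <= M * exp (w * t) * norm x).
  { intros t x Ht; apply Rle_trans with (1 := HdM t x Ht).
    apply Rmult_le_compat_r; [apply (norm_ge_0 (V := W))|].
    rewrite <- (Rmult_1_r M) at 1; apply Rmult_le_compat_l; [lra|].
    apply Rle_trans with (2 := exp_ineq1_le (w * t)).
    assert (0 <= w * t) by (apply Rmult_le_pos; lra); lra. }
  induction n as [|n IH]; intros t x Ht.
  - apply Hsmall; simpl in Ht; lra.
  - rewrite S_INR in Ht.
    destruct (Rle_lt_dec t d) as [Htd|Htd]; [apply Hsmall; lra|].
    replace t with (d + (t - d)) at 1 by ring.
    rewrite T_add by lra.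
    apply Rle_trans with (1 := HdM d _ (conj (Rlt_le _ _ Hd) (Rle_refl d))).
    assert (Ht' : 0 <= t - d <= INR n * d) by lra.
    specialize (IH (t - d) x Ht').
    apply Rle_trans with (exp (w * d) * norm (T (t - d) x)).
    + apply Rmult_le_compat_r; [apply (norm_ge_0 (V := W))|exact HMw].
    + apply Rmult_le_compat_l with (r := exp (w * d)) in IH; [|left; apply exp_pos].
      apply Rle_trans with (1 := IH); right.
      replace (w * t) with (w * d + w * (t - d)) by ring.
      rewrite exp_plus; ring. }
exists w, M; repeat split; [exact Hw|exact HM|].
intros t x Ht; destruct (INR_unbounded (t / d)) as [n Hn].
apply (H n); split; [exact Ht|].
apply Rmult_lt_compat_r with (r := d) in Hn; [|exact Hd].
replace (t / d * d) with t in Hn by (field; lra); lra.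
Qed.

(** * An equivalent norm adapted to the semigroup *)

Variables (w M : R).
Hypothesis Hw : 0 < w.
Hypothesis HM : 1 <= M.
Hypothesis Hexp : forall t x, 0 <= t -> norm (T t x) <= M * exp (w * t) * norm x.

(* [orbit_le r x] says that [x] has norm at most [r] in the equivalent norm
   [sup_t exp (- w t) * norm (T t x)], for which [T t] has norm at most
   [exp (w t)] without the constant [M]. *)
Definition orbit_le (r : R) (x : X) : Prop :=
  forall t, 0 <= t -> norm (T t x) <= r * exp (w * t).

Lemma orbit_le_norm r x : orbit_le r x -> norm x <= r.
Proof.
intros H; specialize (H 0 (Rle_refl 0)).
now rewrite T0, Rmult_0_r, exp_0, Rmult_1_r in H.
Qed.

Lemma norm_orbit_le x : orbit_le (M * norm x) x.
Proof.
intros t Ht; apply Rle_trans with (1 := Hexp t x Ht); right; ring.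
Qed.

Lemma orbit_le_T h r x : 0 <= h -> orbit_le r x -> orbit_le (r * exp (w * h)) (T h x).
Proof.
intros Hh H t Ht; rewrite <- T_add by lra.
apply Rle_trans with (r * exp (w * (t + h))); [apply H; lra|right].
rewrite Rmult_plus_distr_l, exp_plus; ring.
Qed.

Lemma orbit_le_plus r s x y : orbit_le r x -> orbit_le s y -> orbit_le (r + s) (plus x y).
Proof.
intros Hx Hy t Ht.
rewrite (linear_plus _ (T_linear t Ht)).
apply Rle_trans with (1 := norm_triangle (V := W) (T t x) (T t y)).
rewrite Rmult_plus_distr_r; apply Rplus_le_compat; auto.
Qed.

Lemma orbit_le_scal a r x :
  0 <= a -> orbit_le r x -> orbit_le (a * r) (scal (RtoC a) x).
Proof.
intros Ha Hx t Ht.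
rewrite (linear_scal _ (T_linear t Ht)).
apply Rle_trans with (1 := norm_real_scal_le X a (T t x)).
rewrite Rabs_pos_eq, Rmult_assoc by exact Ha.
apply Rmult_le_compat_l; auto.
Qed.

Lemma orbit_le_weaken r s x : r <= s -> orbit_le r x -> orbit_le s x.
Proof.
intros Hrs H t Ht; apply Rle_trans with (1 := H t Ht).
apply Rmult_le_compat_r; [left; apply exp_pos|exact Hrs].
Qed.

Lemma orbit_le_zero r : 0 <= r -> orbit_le r zero.
Proof.
intros Hr; apply orbit_le_weaken with (M * norm (zero : X)); [|apply norm_orbit_le].
rewrite norm_zero_vector; lra.
Qed.

Lemma orbit_le_nonneg r x : orbit_le r x -> 0 <= r.
Proof.
intros H; apply orbit_le_norm in H.
apply Rle_trans with (2 := H), (norm_ge_0 (V := W)).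
Qed.

Lemma orbit_le_lim {S : Type} {F : (S -> Prop) -> Prop} {FF : ProperFilter F}
  (f : S -> X) r x :
  filterlim f F (locally x) -> F (fun s => orbit_le r (f s)) -> orbit_le r x.
Proof.
intros Hf Hr t Ht.
apply (norm_lim_le X (F := F) (fun s => T t (f s))).
- apply (lim_linear X (F := F)); auto.
- apply (filter_imp (F := F) (fun s => orbit_le r (f s))); auto.
Qed.

(** * Inverting the difference quotient *)

Variable l : R.
Hypothesis Hl : w < l.

(* [shifted_quotient h] approximates [l - A] as [h] tends to [0]. *)
Definition shifted_quotient (h : R) (x : X) : X :=
  minus (scal (RtoC (exp (l * h) / h)) x) (scal (RtoC (/ h)) (T h x)).

Lemma shifted_quotient_linear h : 0 < h -> is_linear (shifted_quotient h).
Proof.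
intros Hh; assert (HTh := T_linear h (Rlt_le _ _ Hh)); split.
- intros x y; unfold shifted_quotient; rewrite (linear_plus _ HTh).
  set (a := exp (l * h) / h); vector X.
- intros k x; unfold shifted_quotient; rewrite (linear_scal _ HTh).
  set (a := exp (l * h) / h).
  change (minus (scal (RtoC a) (scal k x)) (scal (RtoC (/ h)) (scal k (T h x))) =
    scal k (minus (scal (RtoC a) x) (scal (RtoC (/ h)) (T h x)))).
  vector X.
- destruct (linear_norm _ HTh) as [m [Hm Hb]].
  exists (Rabs (exp (l * h) / h) + Rabs (/ h) * m); split.
  + assert (0 < Rabs (/ h) * m); [|generalize (Rabs_pos (exp (l * h) / h)); lra].
    apply Rmult_lt_0_compat; [|exact Hm].
    apply Rabs_pos_lt, Rinv_neq_0_compat; lra.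
  + intros x; unfold shifted_quotient, minus.
    eapply Rle_trans; [apply (norm_triangle (V := W))|].
    rewrite (norm_opp (V := W)), Rmult_plus_distr_r.
    apply Rplus_le_compat; [apply norm_real_scal_le|].
    eapply Rle_trans; [apply norm_real_scal_le|].
    rewrite Rmult_assoc; apply Rmult_le_compat_l; [apply Rabs_pos|apply Hb].
Qed.

(** Solving [shifted_quotient h u = y] for the term exp (l h) u gives the fixed-point equation
    [u = G h y u]; in the orbit norm [G h y] is a contraction with factor [q h]. *)
Let q h := exp (- ((l - w) * h)).
Let G h y v := scal (RtoC (exp (- (l * h)))) (plus (T h v) (scal (RtoC h) y)).

Let exp_cancel a x : scal (RtoC (exp a)) (scal (RtoC (exp (- a))) x) = x.
Proof.
rewrite exp_Ropp; apply real_scal_inv; generalize (exp_pos a); lra.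
Qed.

Let exp_cancel' a x : scal (RtoC (exp (- a))) (scal (RtoC (exp a)) x) = x.
Proof. rewrite <- (Ropp_involutive a) at 2; apply exp_cancel. Qed.

Lemma shifted_quotient_scal h u :
  0 < h -> scal (RtoC h) (shifted_quotient h u) =
           minus (scal (RtoC (exp (l * h))) u) (T h u).
Proof.
intros Hh; unfold shifted_quotient.
transitivity (minus (scal (RtoC h) (scal (RtoC (/ h)) (scal (RtoC (exp (l * h))) u)))
  (scal (RtoC h) (scal (RtoC (/ h)) (T h u)))).
- set (e := exp (l * h)); replace (e / h) with (/ h * e) by (field; lra); vector X.
- rewrite !real_scal_inv by lra; reflexivity.
Qed.

Let fixed_point_iff h y u : 0 < h -> shifted_quotient h u = y <-> u = G h y u.
Proof.
intros Hh; unfold G; split; intros H.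
- rewrite <- H, shifted_quotient_scal by exact Hh.
  transitivity (scal (RtoC (exp (- (l * h)))) (scal (RtoC (exp (l * h))) u)).
  + now rewrite exp_cancel'.
  + f_equal; set (e := exp (l * h)); vector X.
- assert (E : scal (RtoC h) (shifted_quotient h u) = scal (RtoC h) y).
  { rewrite shifted_quotient_scal by exact Hh; rewrite H at 1.
    rewrite exp_cancel; vector X. }
  rewrite <- (real_scal_inv X (/ h) (shifted_quotient h u)),
    <- (real_scal_inv X (/ h) y), Rinv_inv, E; [reflexivity| |];
    apply Rinv_neq_0_compat; lra.
Qed.

Let q_lt_1 h : 0 < h -> 0 <= q h < 1.
Proof.
intros Hh; unfold q; split; [left; apply exp_pos|].
rewrite <- exp_0; apply exp_increasing.
assert (0 < (l - w) * h) by (apply Rmult_lt_0_compat; lra); lra.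
Qed.

Let orbit_le_contract h s v : 0 < h -> orbit_le s v ->
  orbit_le (q h * s) (scal (RtoC (exp (- (l * h)))) (T h v)).
Proof.
intros Hh Hs.
replace (q h * s) with (exp (- (l * h)) * (s * exp (w * h))).
- apply orbit_le_scal; [left; apply exp_pos|].
  apply orbit_le_T; [lra|exact Hs].
- unfold q; replace (- ((l - w) * h)) with (- (l * h) + w * h) by ring.
  rewrite exp_plus; ring.
Qed.

(* The defect of [r / (l - w)] is absorbed because [1 + x <= exp x] at
   [x = (l - w) * h]. *)
Let orbit_le_G h y v r a : 0 < h -> orbit_le r y ->
  orbit_le (r / (l - w) + a) v -> orbit_le (r / (l - w) + q h * a) (G h y v).
Proof.
intros Hh Hy Hv.
assert (Hr := orbit_le_nonneg r y Hy).
apply orbit_le_weaken with (q h * (r / (l - w) + a) + exp (- (l * h)) * (h * r)).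
- assert (E1 : exp (- (l * h)) <= q h).
  { unfold q; left; apply exp_increasing.
    assert (0 < w * h) by (apply Rmult_lt_0_compat; lra); lra. }
  assert (E2 : exp (- (l * h)) * (h * r) <= q h * (h * r)).
  { apply Rmult_le_compat_r; [apply Rmult_le_pos; lra|exact E1]. }
  assert (E3 : q h * (1 + (l - w) * h) <= 1).
  { unfold q; apply Rle_trans with
      (exp (- ((l - w) * h)) * exp ((l - w) * h)).
    - apply Rmult_le_compat_l; [left; apply exp_pos|apply exp_ineq1_le].
    - rewrite <- exp_plus, Rplus_opp_l, exp_0; lra. }
  assert (E4 : q h * (r / (l - w)) + q h * (h * r) <= r / (l - w)).
  { replace (q h * (r / (l - w)) + q h * (h * r)) with
      (r / (l - w) * (q h * (1 + (l - w) * h))) by (field; lra).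
    rewrite <- (Rmult_1_r (r / (l - w))) at 2.
    apply Rmult_le_compat_l; [|exact E3].
    apply Rmult_le_pos; [exact Hr|left; apply Rinv_0_lt_compat; lra]. }
  lra.
- replace (G h y v) with (plus (scal (RtoC (exp (- (l * h)))) (T h v))
    (scal (RtoC (exp (- (l * h)))) (scal (RtoC h) y))).
  + apply orbit_le_plus; [now apply orbit_le_contract|].
    apply orbit_le_scal; [left; apply exp_pos|].
    apply orbit_le_scal; [lra|exact Hy].
  + unfold G; set (e := exp (- (l * h))); vector X.
Qed.

(** [u] is a fixed point of [G], so every application of [orbit_le_G] multiplies the excess over r /
    (l - w) by [q h]. The crude bound [M * norm u] starts the iteration and disappears in the
    limit. *)
Lemma shifted_quotient_bound h u r :
  0 < h -> orbit_le r (shifted_quotient h u) -> orbit_le (r / (l - w)) u.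
Proof.
intros Hh Hr.
assert (E := proj1 (fixed_point_iff h _ u Hh) eq_refl).
assert (Hr0 := orbit_le_nonneg _ _ Hr).
assert (H : forall n, orbit_le (r / (l - w) + q h ^ n * (M * norm u)) u).
{ induction n as [|n IH].
  - apply orbit_le_weaken with (M * norm u); [|apply norm_orbit_le].
    assert (0 <= r / (l - w)).
    { apply Rmult_le_pos; [exact Hr0|left; apply Rinv_0_lt_compat; lra]. }
    simpl; lra.
  - simpl; rewrite Rmult_assoc.
    assert (H := orbit_le_G h _ u r _ Hh Hr IH); now rewrite <- E in H. }
intros t Ht.
apply le_of_geometric with (M * norm u * exp (w * t)) (q h); [now apply q_lt_1|].
intros n; apply Rle_trans with (1 := H n t Ht); right; ring.
Qed.

(** Banach iteration of [G h y] from zero: differences contract in the orbit norm, which dominates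
    the original one, so the completeness of [X] applies. *)
Lemma shifted_quotient_surjective h y : 0 < h -> exists u, shifted_quotient h u = y.
Proof.
intros Hh.
pose (s := fun n => Nat.iter n (G h y) zero).
pose (r := M * norm y).
assert (Hy : orbit_le r y) by apply norm_orbit_le.
assert (Hr : 0 <= r / (l - w)).
{ apply Rmult_le_pos; [exact (orbit_le_nonneg _ _ Hy)|].
  left; apply Rinv_0_lt_compat; lra. }
assert (Hb : forall n, orbit_le (r / (l - w)) (s n)).
{ induction n as [|n IH]; [now apply orbit_le_zero|].
  (* Excess 0: the orbit ball of radius r / (l - w) is mapped into itself. *)
  replace (r / (l - w)) with (r / (l - w) + q h * 0) by ring.
  apply orbit_le_G; [exact Hh|exact Hy|rewrite Rplus_0_r; exact IH]. }
assert (HTh := T_linear h (Rlt_le _ _ Hh)).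
assert (Hc : forall n k, orbit_le (q h ^ n * (r / (l - w))) (minus (s (n + k)%nat) (s n))).
{ induction n as [|n IH]; intros k.
  - simpl pow; rewrite Rmult_1_l.
    replace (minus (s (0 + k)%nat) (s 0%nat)) with (s k); [apply Hb|].
    change (s k = minus (s k) zero); vector X.
  - replace (minus (s (S n + k)%nat) (s (S n))) with
      (scal (RtoC (exp (- (l * h)))) (T h (minus (s (n + k)%nat) (s n)))).
    + simpl pow; rewrite Rmult_assoc; now apply orbit_le_contract.
    + change (s (S n + k)%nat) with (G h y (s (n + k)%nat)).
      change (s (S n)) with (G h y (s n)).
      rewrite (linear_sub X _ _ _ HTh); unfold G.
      set (e := exp (- (l * h))); vector X. }
destruct (seq_cauchy_lim X s (fun n => q h ^ n * (r / (l - w)))) as [u Hu].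
- replace 0 with (0 * (r / (l - w))) by ring.
  apply is_lim_seq_mult'; [|apply is_lim_seq_const].
  destruct (q_lt_1 h Hh); apply is_lim_seq_geom; rewrite Rabs_pos_eq; lra.
- intros n m Hnm; apply orbit_le_norm.
  replace m with (n + (m - n))%nat by lia; apply Hc.
- exists u; apply fixed_point_iff; [exact Hh|].
  apply (lim_unique X (F := eventually) (fun n => s (S n))).
  + apply filterlim_comp with (2 := Hu).
    intros P [N HN]; exists N; intros n Hn; apply HN; lia.
  + change (filterlim (fun n => G h y (s n)) eventually (locally (G h y u))).
    unfold G; apply (lim_scal X (F := eventually)), (lim_plus X (F := eventually)).
    * now apply (lim_linear X (F := eventually)).
    * apply filterlim_const.
Qed.

Definition approx_resolvent (h : R) (y : X) : X :=
  epsilon (inhabits zero) (fun u => shifted_quotient h u = y).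

Lemma approx_resolvent_right h y :
  0 < h -> shifted_quotient h (approx_resolvent h y) = y.
Proof.
intros Hh; exact (epsilon_spec (inhabits zero) (fun u => shifted_quotient h u = y)
  (shifted_quotient_surjective h y Hh)).
Qed.

Lemma approx_resolvent_bound h y r :
  0 < h -> orbit_le r y -> orbit_le (r / (l - w)) (approx_resolvent h y).
Proof.
intros Hh Hy; apply (shifted_quotient_bound h); [exact Hh|].
now rewrite approx_resolvent_right.
Qed.

Lemma shifted_quotient_injective h u v :
  0 < h -> shifted_quotient h u = shifted_quotient h v -> u = v.
Proof.
intros Hh E.
assert (H : norm (minus u v) <= 0 / (l - w)).
{ apply orbit_le_norm, (shifted_quotient_bound h); [exact Hh|].
  rewrite (linear_sub X _ _ _ (shifted_quotient_linear h Hh)), E.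
  replace (minus (shifted_quotient h v) (shifted_quotient h v)) with (zero : X) by vector X.
  apply orbit_le_zero; lra. }
unfold Rdiv in H; rewrite Rmult_0_l in H.
assert (E0 : minus u v = zero).
{ apply (norm_eq_zero (V := W)), Rle_antisym; [exact H|apply (norm_ge_0 (V := W))]. }
transitivity (plus (minus u v) v); [vector X|rewrite E0; vector X].
Qed.

Lemma approx_resolvent_left h u :
  0 < h -> approx_resolvent h (shifted_quotient h u) = u.
Proof.
intros Hh; apply (shifted_quotient_injective h); [exact Hh|].
now apply approx_resolvent_right.
Qed.

Let K := M / (l - w).

Let K_pos : 0 < K.
Proof. apply Rdiv_lt_0_compat; lra. Qed.

Lemma approx_resolvent_norm h y :
  0 < h -> norm (approx_resolvent h y) <= K * norm y.
Proof.
intros Hh; apply orbit_le_norm.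
replace (K * norm y) with (M * norm y / (l - w)) by (unfold K; field; lra).
apply approx_resolvent_bound; [exact Hh|apply norm_orbit_le].
Qed.

Lemma approx_resolvent_linear h : 0 < h -> is_linear (approx_resolvent h).
Proof.
intros Hh; assert (HB := shifted_quotient_linear h Hh); split.
- intros x y; apply (shifted_quotient_injective h); [exact Hh|].
  rewrite (linear_plus _ HB), !approx_resolvent_right by exact Hh; reflexivity.
- intros k x; apply (shifted_quotient_injective h); [exact Hh|].
  rewrite (linear_scal _ HB), !approx_resolvent_right by exact Hh; reflexivity.
- exists K; split; [exact K_pos|].
  intros x; now apply approx_resolvent_norm.
Qed.

Let shifted_quotient_comm L h x : is_linear L ->
  (forall z, L (T h z) = T h (L z)) ->
  L (shifted_quotient h x) = shifted_quotient h (L x).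
Proof.
intros HL Hc; unfold shifted_quotient.
rewrite (linear_sub X _ _ _ HL), !(linear_scal _ HL), Hc; reflexivity.
Qed.

Lemma approx_resolvent_comm L h x : 0 < h -> is_linear L ->
  (forall z, L (T h z) = T h (L z)) ->
  L (approx_resolvent h x) = approx_resolvent h (L x).
Proof.
intros Hh HL Hc; apply (shifted_quotient_injective h); [exact Hh|].
rewrite <- shifted_quotient_comm, !approx_resolvent_right by assumption; reflexivity.
Qed.

Let T_comm s t x : 0 <= s -> 0 <= t -> T s (T t x) = T t (T s x).
Proof. intros Hs Ht; rewrite <- !T_add by assumption; f_equal; ring. Qed.

(** The operators [T s] commute, hence so do the two inverses. With both inverses outside, their
    uniform bounds reduce convergence to that of [shifted_quotient h y]. *)
Lemma approx_resolvent_sub g h y : 0 < g -> 0 < h ->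
  minus (approx_resolvent h y) (approx_resolvent g y) =
  approx_resolvent h (approx_resolvent g
    (minus (shifted_quotient g y) (shifted_quotient h y))).
Proof.
intros Hg Hh.
assert (Lg := approx_resolvent_linear g Hg); assert (Lh := approx_resolvent_linear h Hh).
rewrite (linear_sub X _ _ _ Lg), (linear_sub X _ _ _ Lh).
rewrite approx_resolvent_left by exact Hg.
rewrite (approx_resolvent_comm (approx_resolvent h) g); [|exact Hg|exact Lh|].
- now rewrite approx_resolvent_left.
- intros z; symmetry; apply approx_resolvent_comm; [exact Hh|apply T_linear; lra|].
  intros; apply T_comm; lra.
Qed.

(** * The resolvent as the limit of the inverses *)

Variable A : LinOp X X.
Hypothesis HA : closed_op A.
Hypothesis HdA : densely_defined A.
Hypothesis HG : is_generator A T.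

Let quotient_sum h x : 0 < h ->
  plus (shifted_quotient h x) (scal (RtoC (/ h)) (minus (T h x) x)) =
  scal (RtoC ((exp (l * h) - 1) / h)) x.
Proof.
intros Hh; unfold shifted_quotient, Rdiv; set (e := exp (l * h)); vector X.
Qed.

Let lim_growth x :
  filterlim (fun h => scal (RtoC ((exp (l * h) - 1) / h)) x) (at_right 0)
    (locally (scal (RtoC l) x)).
Proof.
apply (lim_norm X (F := at_right 0)); intros eps Heps.
assert (Hn := norm_ge_0 (V := W) x).
assert (Hd : 0 < eps / (norm x + 1)) by (apply Rdiv_lt_0_compat; lra).
assert (H := proj1 (filterlim_locally (F := at_right 0) _ _) (exp_difference_quotient l)
  (mkposreal _ Hd)).
revert H; apply (filter_imp (F := at_right 0)); intros h H.
change (Rabs ((exp (l * h) - 1) / h - l) < eps / (norm x + 1)) in H.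
set (c := (exp (l * h) - 1) / h) in *.
apply Rle_lt_trans with (norm (scal (RtoC (c - l)) x)); [right; f_equal; vector X|].
rewrite (norm_real_scal X).
apply Rle_lt_trans with (eps / (norm x + 1) * norm x).
- apply Rmult_le_compat_r; lra.
- apply Rlt_le_trans with (eps / (norm x + 1) * (norm x + 1)).
  + apply Rmult_lt_compat_l; lra.
  + right; field; lra.
Qed.

(** The shifted quotient is (exp (l h) - 1) / h times x, minus the quotient that defines the
    generator. Being an equivalence, it also serves to prove membership in the domain. *)
Lemma lim_shifted_quotient x z :
  filterlim (fun h => shifted_quotient h x) (at_right 0) (locally z) <->
  dom A x /\ op A x = minus (scal (RtoC l) x) z.
Proof.
rewrite (HG x _); split; intros H.
- replace (minus (scal (RtoC l) x) z) with
    (plus (scal (RtoC l) x) (scal (Copp (RtoC 1)) z)) by vector X.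
  apply (filterlim_ext_loc (F := at_right 0)
    (fun h => plus (scal (RtoC ((exp (l * h) - 1) / h)) x)
       (scal (Copp (RtoC 1)) (shifted_quotient h x)))).
  + generalize at_right_positive; apply (filter_imp (F := at_right 0)); intros h Hh.
    rewrite <- quotient_sum by exact Hh; vector X.
  + apply (lim_plus X (F := at_right 0)); [apply lim_growth|].
    now apply (lim_scal X (F := at_right 0)).
- replace z with (plus (scal (RtoC l) x)
    (scal (Copp (RtoC 1)) (minus (scal (RtoC l) x) z))) by vector X.
  apply (filterlim_ext_loc (F := at_right 0)
    (fun h => plus (scal (RtoC ((exp (l * h) - 1) / h)) x)
       (scal (Copp (RtoC 1)) (scal (RtoC (/ h)) (minus (T h x) x))))).
  + generalize at_right_positive; apply (filter_imp (F := at_right 0)); intros h Hh.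
    rewrite <- quotient_sum by exact Hh; vector X.
  + apply (lim_plus X (F := at_right 0)); [apply lim_growth|].
    now apply (lim_scal X (F := at_right 0)).
Qed.

Lemma approx_resolvent_converges y :
  exists u, filterlim (fun h => approx_resolvent h y) (at_right 0) (locally u).
Proof.
apply (cauchy_lim X (F := at_right 0)); intros eps Heps.
(* Replacing [y] by [y'] costs eps / 4 at each of the two parameters; the remaining eps / 2 goes to
   [y'], where [K * K] bounds the two inverses. *)
assert (Hd : 0 < eps / (4 * K)) by (apply Rdiv_lt_0_compat; lra).
destruct (HdA y (mkposreal _ Hd)) as [y' [Hy' Hyy']]; simpl in Hyy'.
assert (HB : filterlim (fun h => shifted_quotient h y') (at_right 0)
  (locally (minus (scal (RtoC l) y') (op A y')))).
{ apply lim_shifted_quotient; split; [exact Hy'|vector X]. }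
set (z := minus (scal (RtoC l) y') (op A y')) in HB.
assert (KK : 0 < K * K) by now apply Rmult_lt_0_compat.
assert (He : 0 < eps / (4 * (K * K))) by (apply Rdiv_lt_0_compat; lra).
assert (HB' := proj1 (lim_norm X (F := at_right 0) _ z) HB _ He).
exists (fun h => 0 < h /\ norm (minus (shifted_quotient h y') z) < eps / (4 * (K * K))).
split; [exact (filter_and (F := at_right 0) _ _ at_right_positive HB')|].
intros s t [Hs Hsz] [Ht Htz].
assert (D : forall h, 0 < h ->
  norm (minus (approx_resolvent h y') (approx_resolvent h y)) < eps / 4).
{ intros h Hh.
  rewrite <- (linear_sub X _ _ _ (approx_resolvent_linear h Hh)).
  apply Rle_lt_trans with (1 := approx_resolvent_norm h _ Hh).
  replace (eps / 4) with (K * (eps / (4 * K))) by (field; lra).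
  now apply Rmult_lt_compat_l. }
assert (D' : norm (minus (approx_resolvent s y') (approx_resolvent t y')) <= eps / 2).
{ rewrite approx_resolvent_sub by assumption.
  apply Rle_trans with (1 := approx_resolvent_norm s _ Hs).
  apply Rle_trans with (K * (K * (2 * (eps / (4 * (K * K)))))).
  - apply Rmult_le_compat_l; [lra|].
    apply Rle_trans with (1 := approx_resolvent_norm t _ Ht).
    apply Rmult_le_compat_l; [lra|].
    assert (H := norm_sub_triangle X z (shifted_quotient t y') (shifted_quotient s y')).
    rewrite (norm_sub_sym X z) in H; lra.
  - right; field; lra. }
assert (Ds := D s Hs); assert (Dt := D t Ht).
assert (H1 := norm_sub_triangle X (approx_resolvent s y') (approx_resolvent s y)
  (approx_resolvent t y)).
assert (H2 := norm_sub_triangle X (approx_resolvent t y') (approx_resolvent s y')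
  (approx_resolvent t y)).
rewrite (norm_sub_sym X (approx_resolvent s y) (approx_resolvent s y')) in H1; lra.
Qed.

Let S (y : X) : X :=
  epsilon (inhabits zero)
    (fun u => filterlim (fun h => approx_resolvent h y) (at_right 0) (locally u)).

Let S_lim y : filterlim (fun h => approx_resolvent h y) (at_right 0) (locally (S y)).
Proof. exact (epsilon_spec (inhabits zero) _ (approx_resolvent_converges y)). Qed.

Let S_bound y r : orbit_le r y -> orbit_le (r / (l - w)) (S y).
Proof.
intros Hy; apply (orbit_le_lim (F := at_right 0) _ _ _ (S_lim y)).
generalize at_right_positive; apply (filter_imp (F := at_right 0)); intros h Hh.
now apply approx_resolvent_bound.
Qed.

Let S_norm y : norm (S y) <= K * norm y.
Proof.
apply orbit_le_norm.
replace (K * norm y) with (M * norm y / (l - w)) by (unfold K; field; lra).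
apply S_bound, norm_orbit_le.
Qed.

Let S_linear : is_linear S.
Proof.
split.
- intros x y; apply (lim_unique X (F := at_right 0) _ _ _ (S_lim (plus x y))).
  apply (filterlim_ext_loc (F := at_right 0)
    (fun h => plus (approx_resolvent h x) (approx_resolvent h y))).
  + generalize at_right_positive; apply (filter_imp (F := at_right 0)); intros h Hh.
    symmetry; apply (linear_plus _ (approx_resolvent_linear h Hh)).
  + now apply (lim_plus X (F := at_right 0)).
- intros k x; apply (lim_unique X (F := at_right 0) _ _ _ (S_lim (scal k x))).
  apply (filterlim_ext_loc (F := at_right 0)
    (fun h => scal k (approx_resolvent h x))).
  + generalize at_right_positive; apply (filter_imp (F := at_right 0)); intros h Hh.
    symmetry; apply (linear_scal _ (approx_resolvent_linear h Hh)).
  + now apply (lim_scal X (F := at_right 0)).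
- exists K; split; [exact K_pos|exact S_norm].
Qed.

(** With z = (l - A) x, the error [approx_resolvent h z] - x is [approx_resolvent h] applied to z -
    [shifted_quotient h x]; this argument tends to 0 and the operators are bounded by [K]. *)
Let S_left x : dom A x -> S (minus (scal (RtoC l) x) (op A x)) = x.
Proof.
intros Hx; set (z := minus (scal (RtoC l) x) (op A x)).
assert (HB : filterlim (fun h => shifted_quotient h x) (at_right 0) (locally z)).
{ apply lim_shifted_quotient; split; [exact Hx|unfold z; vector X]. }
apply (lim_unique X (F := at_right 0) _ _ _ (S_lim z)).
apply (lim_norm X (F := at_right 0)); intros eps Heps.
assert (He : 0 < eps / K) by (apply Rdiv_lt_0_compat; lra).
generalize (filter_and (F := at_right 0) _ _ at_right_positive
  (proj1 (lim_norm X (F := at_right 0) _ z) HB _ He)).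
apply (filter_imp (F := at_right 0)); intros h [Hh H].
rewrite <- (approx_resolvent_left h x Hh) at 1.
rewrite <- (linear_sub X _ _ _ (approx_resolvent_linear h Hh)).
apply Rle_lt_trans with (1 := approx_resolvent_norm h _ Hh).
rewrite (norm_sub_sym X).
replace eps with (K * (eps / K)) by (field; lra).
now apply Rmult_lt_compat_l.
Qed.

Let S_comm g y : 0 < g -> shifted_quotient g (S y) = S (shifted_quotient g y).
Proof.
intros Hg; assert (HB := shifted_quotient_linear g Hg).
apply (lim_unique X (F := at_right 0) (fun h => shifted_quotient g (approx_resolvent h y))).
- apply (lim_linear X (F := at_right 0)); [exact HB|apply S_lim].
- apply (filterlim_ext_loc (F := at_right 0)
    (fun h => approx_resolvent h (shifted_quotient g y))); [|apply S_lim].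
  generalize at_right_positive; apply (filter_imp (F := at_right 0)); intros h Hh.
  symmetry; apply approx_resolvent_comm; [exact Hh|exact HB|].
  intros z; symmetry; apply shifted_quotient_comm; [apply T_linear; lra|].
  intros; apply T_comm; lra.
Qed.

(** The quotients commute with [S], so at [S y] they converge to [S] of (l - A) y, which is y by
    [S_left]; convergence is what puts [S y] in the domain. *)
Let S_right_dom y : dom A y ->
  dom A (S y) /\ op A (S y) = minus (scal (RtoC l) (S y)) y.
Proof.
intros Hy; apply lim_shifted_quotient.
assert (H : filterlim (fun h => S (shifted_quotient h y)) (at_right 0)
  (locally (S (minus (scal (RtoC l) y) (op A y))))).
{ apply (lim_linear X (F := at_right 0)); [exact S_linear|].
  apply lim_shifted_quotient; split; [exact Hy|vector X]. }
rewrite (S_left y Hy) in H; revert H.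
apply (filterlim_ext_loc (F := at_right 0)).
generalize at_right_positive; apply (filter_imp (F := at_right 0)); intros h Hh.
now symmetry; apply S_comm.
Qed.

(** The pairs (S y', l S y' - y') with y' in the domain lie in the graph of A and approach the pair
    for y; the graph is closed. *)
Let S_right y : dom A (S y) /\ op A (S y) = minus (scal (RtoC l) (S y)) y.
Proof.
enough (H : dom A (S y) /\ minus (scal (RtoC l) (S y)) y = op A (S y)).
{ destruct H as [H1 H2]; now rewrite <- H2. }
apply (HA (S y, minus (scal (RtoC l) (S y)) y)).
(* [closed] is used in its negative form: a neighbourhood free of graph points is assumed and
   refuted. *)
intros [eps Hloc].
assert (Heps := cond_pos eps).
(* An error in [y] is multiplied by at most [K] in the first component and [l * K + 1] in the
   second. *)
assert (Hc : 0 < K + l * K + 1).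
{ assert (0 < l * K) by (apply Rmult_lt_0_compat; lra); lra. }
assert (Hd : 0 < eps / (K + l * K + 1)) by (apply Rdiv_lt_0_compat; lra).
destruct (HdA y (mkposreal _ Hd)) as [y' [Hy' Hyy']]; simpl in Hyy'.
set (d := eps / (K + l * K + 1)) in *.
assert (Ed : (K + l * K + 1) * d = eps) by (unfold d; field; lra).
assert (HS : norm (minus (S y') (S y)) <= K * norm (minus y' y)).
{ rewrite <- (linear_sub X _ _ _ S_linear); apply S_norm. }
assert (HKd : K * norm (minus y' y) < K * d) by now apply Rmult_lt_compat_l.
assert (HlK : l * (K * norm (minus y' y)) < l * (K * d))
  by (apply Rmult_lt_compat_l; lra).
assert (HlKd : 0 < l * (K * d))
  by (repeat (apply Rmult_lt_0_compat; try lra)).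
destruct (S_right_dom y' Hy') as [H1 H2].
apply (Hloc (S y', minus (scal (RtoC l) (S y')) y')); [|now split].
split; apply (norm_compat1 (V := W)).
- change (norm (minus (S y') (S y)) < eps).
  assert (H0 := Rmult_lt_0_compat _ _ K_pos Hd); lra.
- change (norm (minus (minus (scal (RtoC l) (S y')) y')
    (minus (scal (RtoC l) (S y)) y)) < eps).
  replace (minus (minus (scal (RtoC l) (S y')) y') (minus (scal (RtoC l) (S y)) y))
    with (minus (scal (RtoC l) (minus (S y') (S y))) (minus y' y)) by vector X.
  apply Rle_lt_trans with
    (norm (scal (RtoC l) (minus (S y') (S y))) + norm (minus y' y)).
  + unfold minus at 1; eapply Rle_trans; [apply (norm_triangle (V := W))|].
    rewrite (norm_opp (V := W)); apply Rle_refl.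
  + rewrite (norm_real_scal X), Rabs_pos_eq by lra.
    assert (l * norm (minus (S y') (S y)) <= l * (K * norm (minus y' y)))
      by (apply Rmult_le_compat_l; lra).
    assert (H0 := Rmult_lt_0_compat _ _ K_pos Hd); lra.
Qed.

(** The estimate stays in the orbit norm, where its constant is 1, so that it can be composed along
    a product. *)
Lemma generator_resolvent :
  exists S, is_resolvent (id_bop X) A (RtoC l) S /\
    forall y r, orbit_le r y -> orbit_le (r / (l - w)) (S y).
Proof.
exists S; split; [|exact S_bound].
split; [exact S_linear|split].
- intros z; destruct (S_right z) as [H1 H2]; split; [exact H1|].
  unfold pencil; simpl; rewrite H2; vector X.
- intros x Hx; exact (S_left x Hx).
Qed.

End Semigroup.

(** * Block-diagonal and nilpotent pencils *)

Lemma op_norm_le_iff (X Z : HilbertSpace) (T : X -> Z) (b : R) :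
  Rbar_le (op_norm T) b <-> forall x, norm x <= 1 -> norm (T x) <= b.
Proof.
destruct (Lub_Rbar_correct (fun r : R => exists x : X, norm x <= 1 /\ r = norm (T x)))
  as [Hub Hlub].
split; intros H.
- intros x Hx.
  apply (Rbar_le_trans (norm (T x)) (op_norm T) b); [|exact H].
  apply Hub; now exists x.
- apply Hlub; intros r [x [Hx ->]]; now apply H.
Qed.

Lemma prod_f_R0_pow (f : nat -> R) (n p : nat) :
  prod_f_R0 (fun k => f k ^ n) p = prod_f_R0 f p ^ n.
Proof.
induction p as [|p IH]; [reflexivity|].
simpl; rewrite IH; symmetry; apply Rpow_mult_distr.
Qed.

Lemma prod_f_R0_pos (f : nat -> R) (p : nat) :
  (forall k, (k <= p)%nat -> 0 < f k) -> 0 < prod_f_R0 f p.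
Proof.
induction p as [|p IH]; intros H; simpl; [now apply H|].
apply Rmult_lt_0_compat; [apply IH; intros; apply H; lia|now apply H].
Qed.

Lemma iter_linear (X : HilbertSpace) (L : X -> X) (k : nat) :
  is_linear L -> is_linear (Nat.iter k L).
Proof.
intros HL; induction k as [|k IH]; [apply is_linear_id|].
exact (is_linear_comp _ _ IH HL).
Qed.

(** [resolvent] is a choice by [epsilon]; this lemma is what identifies it with explicit
    inverses. *)
Lemma resolvent_unique (X Z : HilbertSpace) (E : BoundedOp X Z) (A : LinOp X Z)
  (l : C) (S S' : Z -> X) (z : Z) :
  is_resolvent E A l S -> is_resolvent E A l S' -> S z = S' z.
Proof.
intros [_ [_ HS]] [_ [HS' _]]; destruct (HS' z) as [Hd He].
rewrite <- He at 1; now apply HS.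
Qed.

Lemma resolvent_spec (X Z : HilbertSpace) (E : BoundedOp X Z) (A : LinOp X Z) (l : C) :
  resolvent_set E A l -> is_resolvent E A l (resolvent E A l).
Proof. intros H; apply (epsilon_spec (inhabits (fun _ : Z => zero)) _ H). Qed.

Lemma pencil_zero (X Z : HilbertSpace) (F : BoundedOp X Z) (B : LinOp X Z) (l : C) :
  pencil F B l zero = zero.
Proof.
assert (X0 : scal (RtoC 0) (zero : X) = zero)
  by exact (scal_zero_l (V := CompleteNormedModule.ModuleSpace C_AbsRing X) zero).
assert (Z0 : forall z : Z, scal (RtoC 0) z = zero)
  by exact (scal_zero_l (V := CompleteNormedModule.ModuleSpace C_AbsRing Z)).
assert (HF : F zero = zero).
{ transitivity (F (scal (RtoC 0) zero)); [f_equal; symmetry; exact X0|].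
  etransitivity; [apply (linear_scal _ (bop_is_linear F))|apply Z0]. }
assert (HB : op B zero = zero).
{ transitivity (op B (scal (RtoC 0) zero)); [f_equal; symmetry; exact X0|].
  etransitivity; [apply op_scal, dom_zero|apply Z0]. }
unfold pencil; rewrite HF, HB.
etransitivity; [apply (minus_zero_r (G := CompleteNormedModule.AbelianGroup C_AbsRing Z))|].
exact (scal_zero_r (V := CompleteNormedModule.ModuleSpace C_AbsRing Z) l).
Qed.

(** * Resolvents of a block-diagonal pencil *)

Section DiagonalPencil.

Variables X1 X2 Z1 Z2 : HilbertSpace.
Variables (E1 : BoundedOp X1 Z1) (A1 : LinOp X1 Z1).
Variables (E2 : BoundedOp X2 Z2) (A2 : LinOp X2 Z2).

Lemma norm_fst_le (u : hilbert_sum X1 X2) : norm (fst u) <= norm u.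
Proof.
change (norm u) with (sqrt (norm (fst u) ^ 2 + norm (snd u) ^ 2)).
rewrite <- (sqrt_pow2 (norm (fst u))) at 1 by apply norm_ge_0.
apply sqrt_le_1_alt; generalize (pow2_ge_0 (norm (snd u))); lra.
Qed.

Lemma norm_snd_le (u : hilbert_sum X1 X2) : norm (snd u) <= norm u.
Proof.
change (norm u) with (sqrt (norm (fst u) ^ 2 + norm (snd u) ^ 2)).
rewrite <- (sqrt_pow2 (norm (snd u))) at 1 by apply norm_ge_0.
apply sqrt_le_1_alt; generalize (pow2_ge_0 (norm (fst u))); lra.
Qed.

Lemma norm_inl (x : X1) : norm ((x, zero) : hilbert_sum X1 X2) = norm x.
Proof.
change (sqrt (norm x ^ 2 + norm (zero : X2) ^ 2) = norm x).
rewrite norm_zero_vector.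
replace (norm x ^ 2 + 0 ^ 2) with (norm x ^ 2) by ring.
apply sqrt_pow2, norm_ge_0.
Qed.

Lemma norm_inr (x : X2) : norm ((zero, x) : hilbert_sum X1 X2) = norm x.
Proof.
change (sqrt (norm (zero : X1) ^ 2 + norm x ^ 2) = norm x).
rewrite norm_zero_vector.
replace (0 ^ 2 + norm x ^ 2) with (norm x ^ 2) by ring.
apply sqrt_pow2, norm_ge_0.
Qed.

Let E := diag_bop E1 E2.
Let A := diag_op A1 A2.

Lemma diag_is_resolvent (l : C) (S1 : Z1 -> X1) (S2 : Z2 -> X2) :
  is_resolvent E1 A1 l S1 -> is_resolvent E2 A2 l S2 ->
  is_resolvent E A l (fun u => (S1 (fst u), S2 (snd u))).
Proof.
intros [L1 [R1 I1]] [L2 [R2 I2]]; split; [|split].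
- exact (diag_is_linear (Build_BoundedOp L1) (Build_BoundedOp L2)).
- intros [z1 z2]; destruct (R1 z1) as [d1 e1]; destruct (R2 z2) as [d2 e2].
  split; [now split|].
  change ((pencil E1 A1 l (S1 z1), pencil E2 A2 l (S2 z2)) = (z1, z2)).
  now rewrite e1, e2.
- intros [x1 x2] [d1 d2].
  change ((S1 (pencil E1 A1 l x1), S2 (pencil E2 A2 l x2)) = (x1, x2)).
  now rewrite I1, I2.
Qed.

(** The first component of the pencil depends only on the first component of its argument, so
    compressing [S] works without knowing that its off-diagonal entries vanish. *)
Lemma diag_is_resolvent_fst (l : C) (S : hilbert_sum Z1 Z2 -> hilbert_sum X1 X2) :
  is_resolvent E A l S -> is_resolvent E1 A1 l (fun z => fst (S (z, zero))).
Proof.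
intros [L [R0 I0]]; split; [|split].
- apply (is_linear_comp (U := Z1) (V := hilbert_sum X1 X2) (W := X1)
    (fun z => S (z, zero)) fst).
  + apply (is_linear_comp (U := Z1) (V := hilbert_sum Z1 Z2)
      (fun z => (z, zero)) S); [|exact L].
    apply (is_linear_prod (T := Z1) (U := Z1) (V := Z2) (fun z => z) (fun _ => zero)).
    * apply is_linear_id.
    * apply is_linear_zero.
  + exact (is_linear_fst (U := X1) (V := X2)).
- intros z; destruct (R0 (z, zero)) as [[d _] e]; split; [exact d|].
  exact (f_equal fst e).
- intros x dx.
  assert (H := I0 (x, zero) (conj dx (dom_zero A2))).
  change (S (pencil E1 A1 l x, pencil E2 A2 l zero) = (x, zero)) in H.
  rewrite pencil_zero in H; exact (f_equal fst H).
Qed.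

Lemma diag_is_resolvent_snd (l : C) (S : hilbert_sum Z1 Z2 -> hilbert_sum X1 X2) :
  is_resolvent E A l S -> is_resolvent E2 A2 l (fun z => snd (S (zero, z))).
Proof.
intros [L [R0 I0]]; split; [|split].
- apply (is_linear_comp (U := Z2) (V := hilbert_sum X1 X2) (W := X2)
    (fun z => S (zero, z)) snd).
  + apply (is_linear_comp (U := Z2) (V := hilbert_sum Z1 Z2)
      (fun z => (zero, z)) S); [|exact L].
    apply (is_linear_prod (T := Z2) (U := Z1) (V := Z2) (fun _ => zero) (fun z => z)).
    * apply is_linear_zero.
    * apply is_linear_id.
  + exact (is_linear_snd (U := X1) (V := X2)).
- intros z; destruct (R0 (zero, z)) as [[_ d] e]; split; [exact d|].
  exact (f_equal snd e).
- intros x dx.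
  assert (H := I0 (zero, x) (conj (dom_zero A1) dx)).
  change (S (pencil E1 A1 l zero, pencil E2 A2 l x) = (zero, x)) in H.
  rewrite pencil_zero in H; exact (f_equal snd H).
Qed.

Lemma diag_resolvent_set (l : C) :
  resolvent_set E A l <-> resolvent_set E1 A1 l /\ resolvent_set E2 A2 l.
Proof.
split.
- intros [S HS]; split.
  + exists (fun z => fst (S (z, zero))); now apply diag_is_resolvent_fst.
  + exists (fun z => snd (S (zero, z))); now apply diag_is_resolvent_snd.
- intros [[S1 H1] [S2 H2]].
  exists (fun u => (S1 (fst u), S2 (snd u))); now apply diag_is_resolvent.
Qed.

Lemma diag_resolvent (l : C) (u : hilbert_sum Z1 Z2) :
  resolvent_set E A l ->
  resolvent E A l u = (resolvent E1 A1 l (fst u), resolvent E2 A2 l (snd u)).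
Proof.
intros H; destruct (proj1 (diag_resolvent_set l) H) as [H1 H2].
apply (resolvent_unique _ _ _ _ _ _ _ _ (resolvent_spec _ _ _ _ _ H)
  (diag_is_resolvent l _ _ (resolvent_spec _ _ _ _ _ H1) (resolvent_spec _ _ _ _ _ H2))).
Qed.

Lemma diag_right_resolvent (l : R) (u : hilbert_sum X1 X2) :
  resolvent_set E A (RtoC l) ->
  right_resolvent E A l u =
  (right_resolvent E1 A1 l (fst u), right_resolvent E2 A2 l (snd u)).
Proof. intros H; exact (diag_resolvent (RtoC l) (E u) H). Qed.

Lemma diag_left_resolvent (l : R) (u : hilbert_sum Z1 Z2) :
  resolvent_set E A (RtoC l) ->
  left_resolvent E A l u =
  (left_resolvent E1 A1 l (fst u), left_resolvent E2 A2 l (snd u)).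
Proof. intros H; unfold left_resolvent; now rewrite diag_resolvent. Qed.

End DiagonalPencil.

(** The splitting is required only for [i < k] because [lam] is controlled only on the indices that
    occur. *)
Lemma op_prod_pair (U V : Type) (f : nat -> U * V -> U * V)
  (f1 : nat -> U -> U) (f2 : nat -> V -> V) (k : nat) :
  (forall i u, (i < k)%nat -> f i u = (f1 i (fst u), f2 i (snd u))) ->
  forall u, op_prod f k u = (op_prod f1 k (fst u), op_prod f2 k (snd u)).
Proof.
induction k as [|k IH]; intros H u; [now destruct u|].
simpl; rewrite IH by (intros; apply H; lia).
now rewrite H by lia.
Qed.

Lemma iter_pair (U V : Type) (f : U * V -> U * V) (f1 : U -> U) (f2 : V -> V) (n : nat) :
  (forall u, f u = (f1 (fst u), f2 (snd u))) ->
  forall u, Nat.iter n f u = (Nat.iter n f1 (fst u), Nat.iter n f2 (snd u)).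
Proof.
intros H; induction n as [|n IH]; intros u; [now destruct u|].
simpl; now rewrite H, IH.
Qed.

(** * The nilpotent block *)

Section NilpotentPencil.

Variables (Y : HilbertSpace) (N : BoundedOp Y Y).

Add Ring hilbert_vector_ring : (vector_ring Y).

Let B := linop_of_bop (id_bop Y).

Let N_linear : is_linear N := bop_is_linear N.

Let N_zero (L : Y -> Y) : is_linear L -> L zero = zero.
Proof.
intros HL; transitivity (L (minus zero zero)); [f_equal; vector Y|].
rewrite (linear_sub Y _ _ _ HL); vector Y.
Qed.

(** The inverse is the finite Neumann series -(I + l N + ... + (l N)^(k-1)). *)
Lemma nilpotent_resolvent_set (k : nat) (l : C) :
  vanishing_power N k -> resolvent_set N B l.
Proof.
intros HN.
pose (L := fun x => scal l (N x)).
assert (HL : is_linear L).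
{ apply (is_linear_comp (U := Y) (V := Y) (W := Y) N (fun x => scal l x)); [exact N_linear|].
  apply (is_linear_scal_r (V := Y)); exact Cmult_comm. }
(* Horner's scheme for the sum of the first [j] powers of [L]. *)
pose (P := fun j z => Nat.iter j (fun v => plus z (L v)) zero).
assert (PL : forall j, is_linear (P j)).
{ induction j as [|j IH]; [apply (is_linear_zero (U := Y) (V := Y))|].
  apply (is_linear_comp (U := Y) (V := prod_NormedModule C_AbsRing Y Y) (W := Y)
    (fun z => (z, L (P j z))) (fun p => plus (fst p) (snd p)));
    [|exact (is_linear_plus (V := Y))].
  apply (is_linear_prod (T := Y) (U := Y) (V := Y) (fun z => z) (fun z => L (P j z))).
  - apply is_linear_id.
  - exact (is_linear_comp (U := Y) (V := Y) (W := Y) _ _ IH HL). }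
assert (PC : forall j z, P j (L z) = L (P j z)).
{ induction j as [|j IH]; intros z; [symmetry; now apply N_zero|].
  change (plus (L z) (L (P j (L z))) = L (plus z (L (P j z)))).
  rewrite IH; symmetry; apply (linear_plus _ HL). }
assert (PS : forall j z, P (S j) z = plus (P j z) (Nat.iter j L z)).
{ induction j as [|j IH]; intros z.
  - change (plus z (L zero) = plus zero z).
    transitivity (plus z zero); [f_equal; exact (N_zero L HL)|vector Y].
  - change (plus z (L (P (S j) z)) = plus (plus z (L (P j z))) (L (Nat.iter j L z))).
    rewrite IH.
    assert (E : L (plus (P j z) (Nat.iter j L z)) = plus (L (P j z)) (L (Nat.iter j L z)))
      by apply (linear_plus _ HL).
    rewrite E; vector Y. }
assert (IL : forall j z, exists a : C, Nat.iter j L z = scal a (Nat.iter j N z)).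
{ induction j as [|j IH]; intros z; [exists (RtoC 1); simpl; vector Y|].
  destruct (IH z) as [a Ha]; exists (Cmult l a).
  simpl; rewrite Ha; unfold L at 1.
  assert (E : N (scal a (Nat.iter j N z)) = scal a (N (Nat.iter j N z)))
    by apply (linear_scal _ N_linear).
  rewrite E; vector Y. }
(* The next partial sum adds the k-th power of [L], which is zero. *)
assert (PE : forall z, P k z = plus z (L (P k z))).
{ intros z; change (plus z (L (P k z))) with (P (S k) z); rewrite PS.
  destruct (IL k z) as [a Ha]; rewrite Ha, HN; vector Y. }
exists (fun z => opp (P k z)); split; [|split].
- exact (is_linear_comp (U := Y) (V := Y) (W := Y) _ _ (PL k) (is_linear_opp (V := Y))).
- intros z; split; [exact I|].
  change (minus (L (opp (P k z))) (opp (P k z)) = z).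
  transitivity (minus (P k z) (L (P k z))).
  + replace (L (opp (P k z))) with (opp (L (P k z))); [vector Y|].
    transitivity (minus zero (L (P k z))); [vector Y|].
    transitivity (L (minus zero (P k z))); [|f_equal; vector Y].
    rewrite (linear_sub Y _ _ _ HL); f_equal; symmetry; exact (N_zero L HL).
  + rewrite (PE z) at 1; vector Y.
- intros x _.
  change (opp (P k (minus (L x) x)) = x).
  rewrite (linear_sub Y _ _ _ (PL k)), PC.
  transitivity (minus (P k x) (L (P k x))); [vector Y|].
  rewrite (PE x) at 1; vector Y.
Qed.

Variables (l : C) (S : Y -> Y).
Hypothesis HS : is_resolvent N B l S.

Lemma nilpotent_resolvent_comm (j : nat) (z : Y) :
  Nat.iter j N (S z) = S (Nat.iter j N z).
Proof.
induction j as [|j IH]; [reflexivity|].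
simpl; rewrite IH; destruct HS as [_ [HR HI]].
destruct (HR (Nat.iter j N z)) as [_ E].
set (u := S (Nat.iter j N z)) in *.
rewrite <- E; change (N u = S (N (minus (scal l (N u)) u))).
rewrite (linear_sub Y _ _ _ N_linear), (linear_scal _ N_linear).
symmetry; exact (HI (N u) I).
Qed.

(** On ker N the pencil l N - I is -I for every l; hence the independence of l and the sign. *)
Lemma nilpotent_resolvent_kernel (y : Y) : N y = zero -> S y = opp y.
Proof.
intros Hy; destruct HS as [_ [_ HI]].
rewrite <- (HI (opp y) I); f_equal.
change (y = minus (scal l (N (opp y))) (opp y)).
replace (N (opp y)) with (zero : Y); [vector Y|].
transitivity (minus (N zero) (N y)); [|].
{ rewrite Hy; transitivity (minus zero zero : Y); [vector Y|].
  f_equal; symmetry; exact (N_zero N N_linear). }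
rewrite <- (linear_sub Y _ _ _ N_linear); f_equal; vector Y.
Qed.

End NilpotentPencil.

Section NilpotentProducts.

Variables (Y : HilbertSpace) (N : BoundedOp Y Y).

Let B := linop_of_bop (id_bop Y).

(** Each of the [j] factors takes the vector one step down the chain of kernels, ending in the
    kernel of the identity. *)
Lemma op_prod_vanishes (f : nat -> Y -> Y) (j : nat) :
  (forall k i w, (k < j)%nat -> Nat.iter (S i) N w = zero -> Nat.iter i N (f k w) = zero) ->
  forall w, Nat.iter j N w = zero -> op_prod f j w = zero.
Proof.
induction j as [|j IH]; intros Hf w Hw; [exact Hw|].
simpl; apply IH; [intros; apply Hf; [lia|assumption]|].
apply Hf; [lia|exact Hw].
Qed.

Lemma iter_right_resolvent (l : R) (i : nat) (w : Y) :
  resolvent_set N B (RtoC l) ->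
  Nat.iter i N (right_resolvent N B l w) = resolvent N B (RtoC l) (Nat.iter (S i) N w).
Proof.
intros Hl; unfold right_resolvent.
rewrite (nilpotent_resolvent_comm Y N _ _ (resolvent_spec _ _ _ _ _ Hl)).
now rewrite Nat.iter_succ_r.
Qed.

Lemma iter_left_resolvent (l : R) (i : nat) (w : Y) :
  resolvent_set N B (RtoC l) ->
  Nat.iter i N (left_resolvent N B l w) = resolvent N B (RtoC l) (Nat.iter (S i) N w).
Proof.
intros Hl; unfold left_resolvent; rewrite <- Nat.iter_succ_r.
apply (nilpotent_resolvent_comm Y N _ _ (resolvent_spec _ _ _ _ _ Hl)).
Qed.

Let resolvent_zero (l : C) : resolvent_set N B l -> resolvent N B l zero = zero.
Proof.
intros Hl; destruct (resolvent_spec _ _ _ _ _ Hl) as [_ [_ HI]].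
transitivity (resolvent N B l (pencil N B l zero)); [|apply HI; exact I].
f_equal; symmetry; exact (pencil_zero Y Y N B l).
Qed.

Lemma right_resolvent_lowers (l : R) (i : nat) (w : Y) :
  resolvent_set N B (RtoC l) -> Nat.iter (S i) N w = zero ->
  Nat.iter i N (right_resolvent N B l w) = zero.
Proof.
intros Hl Hw; rewrite iter_right_resolvent by exact Hl.
rewrite Hw; now apply resolvent_zero.
Qed.

Lemma left_resolvent_lowers (l : R) (i : nat) (w : Y) :
  resolvent_set N B (RtoC l) -> Nat.iter (S i) N w = zero ->
  Nat.iter i N (left_resolvent N B l w) = zero.
Proof.
intros Hl Hw; rewrite iter_left_resolvent by exact Hl.
rewrite Hw; now apply resolvent_zero.
Qed.

(** The resolvent acts on N^(j+1) w, which lies in ker N, and merely changes its sign; comparing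
    norms avoids tracking that sign. *)
Lemma norm_op_prod_right_resolvent (lam : nat -> R) (j : nat) :
  (forall k, (k < j)%nat -> resolvent_set N B (RtoC (lam k))) ->
  forall w, Nat.iter (S j) N w = zero ->
  norm (op_prod (fun k => right_resolvent N B (lam k)) j w) = norm (Nat.iter j N w).
Proof.
induction j as [|j IH]; intros Hlam w Hw; [reflexivity|].
assert (Hj := Hlam j (Nat.lt_succ_diag_r j)).
change (norm (op_prod (fun k => right_resolvent N B (lam k)) j
  (right_resolvent N B (lam j) w)) = norm (Nat.iter (S j) N w)).
rewrite IH; [|intros; apply Hlam; lia|now apply right_resolvent_lowers].
rewrite iter_right_resolvent by exact Hj.
transitivity (norm (opp (Nat.iter (S j) N w))).
{ f_equal; exact (nilpotent_resolvent_kernel Y N _ _ (resolvent_spec _ _ _ _ _ Hj) _ Hw). }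
apply (norm_opp (V := CompleteNormedModule.NormedModule C_AbsRing Y)).
Qed.

Lemma vanishing_power_le (j k : nat) :
  (j <= k)%nat -> vanishing_power N j -> vanishing_power N k.
Proof.
intros Hjk Hj x; replace k with (j + (k - j))%nat by lia.
rewrite Nat.iter_add; apply Hj.
Qed.

(** A least vanishing power exists by well-ordering; [classic] stands in for decidability. *)
Lemma nilpotency_degree_le_iff (m : nat) :
  nilpotency_degree_le N m <-> vanishing_power N m.
Proof.
split.
- intros [k [[Hk _] Hkm]]; now apply vanishing_power_le with k.
- intros Hm.
  destruct (dec_inh_nat_subset_has_unique_least_element (vanishing_power N)
    (fun n => classic _) (ex_intro _ m Hm)) as [k [[Hk Hmin] _]].
  exists k; split; [now split|now apply Hmin].
Qed.

End NilpotentProducts.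

(** * Radiality *)

(** One pair [w], [M] serves all [p] and [n]: the product is estimated in the orbit norm, and [M]
    enters when the norm of the initial vector is compared with it. *)
Lemma generator_radial_estimates (X : HilbertSpace) (A : LinOp X X) :
  closed_op A -> densely_defined A -> generates_C0_semigroup A ->
  exists w M, 0 < w /\ 1 <= M /\ ray_in_resolvent_set (id_bop X) A w /\
    forall p n, radial_estimates (id_bop X) A p w M n.
Proof.
intros HA HdA [T [HT HG]].
destruct (semigroup_exponential_bound X T HT) as [w [M [Hw [HM Hexp]]]].
assert (HR := fun l Hl =>
  generator_resolvent X T HT w M Hw HM Hexp l Hl A HA HdA HG).
assert (Hray : ray_in_resolvent_set (id_bop X) A w).
{ intros l Hl; destruct (HR l Hl) as [S [HS _]]; now exists S. }
exists w, M; do 3 (split; [assumption|]).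
intros p n lam Hlam; simpl.
assert (Hres : forall k r y, (k <= p)%nat -> orbit_le X T w r y ->
  orbit_le X T w (r / Rabs (lam k - w)) (resolvent (id_bop X) A (RtoC (lam k)) y)).
{ intros k r y Hk Hy; specialize (Hlam k Hk).
  rewrite Rabs_pos_eq by lra.
  destruct (HR (lam k) Hlam) as [S [HS HSb]].
  rewrite (resolvent_unique _ _ _ _ _ _ _ y (resolvent_spec _ _ _ _ _ (Hray _ Hlam)) HS).
  now apply HSb. }
assert (Hprod : forall j r y, (j <= p)%nat -> orbit_le X T w r y ->
  orbit_le X T w (r / prod_f_R0 (fun k => Rabs (lam k - w)) j)
    (op_prod (fun k => resolvent (id_bop X) A (RtoC (lam k))) (S j) y)).
{ induction j as [|j IH]; intros r y Hj Hy; [now apply (Hres 0%nat)|].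
  apply orbit_le_weaken with (2 := IH _ _ (Nat.lt_le_incl _ _ Hj) (Hres _ _ _ Hj Hy)).
  simpl; unfold Rdiv; rewrite Rinv_mult; right; ring. }
set (P := prod_f_R0 (fun k => Rabs (lam k - w)) p).
assert (HP : 0 < P).
{ apply prod_f_R0_pos; intros k Hk; specialize (Hlam k Hk).
  rewrite Rabs_pos_eq; lra. }
assert (Hiter : forall m r y, orbit_le X T w r y ->
  orbit_le X T w (r / P ^ m) (Nat.iter m
    (op_prod (fun k => resolvent (id_bop X) A (RtoC (lam k))) (S p)) y)).
{ induction m as [|m IH]; intros r y Hy.
  - apply orbit_le_weaken with (2 := Hy); simpl; right; field.
  - simpl Nat.iter.
    apply orbit_le_weaken with (2 := Hprod p _ _ (le_n p) (IH _ _ Hy)).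
    fold P; simpl; right; field; split; [now apply pow_nonzero, Rgt_not_eq|lra]. }
assert (Hfin : forall x, norm x <= 1 -> norm (Nat.iter n
    (op_prod (fun k => resolvent (id_bop X) A (RtoC (lam k))) (p + 1)) x) <=
    M / prod_f_R0 (fun k => Rabs (lam k - w) ^ n) p).
{ intros x Hx; rewrite prod_f_R0_pow, Nat.add_1_r.
  apply (orbit_le_norm X T HT w).
  apply orbit_le_weaken with (2 := Hiter n _ _ (norm_orbit_le X T w M Hexp x)).
  apply Rmult_le_compat_r; [left; now apply Rinv_0_lt_compat, pow_lt|].
  rewrite <- (Rmult_1_r M) at 2; apply Rmult_le_compat_l; lra. }
(* For the identity, left and right resolvents are both convertible to the resolvent. *)
split; apply op_norm_le_iff; exact Hfin.
Qed.

(** * Transfer of the estimates between the blocks and their sum *)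

Section Blocks.

Variables (Y1 Y2 : HilbertSpace) (N : BoundedOp Y2 Y2) (A1 : LinOp Y1 Y1).

Add Ring hilbert_vector_ring : (vector_ring Y2).

Let B := linop_of_bop (id_bop Y2).
Let E := diag_bop (id_bop Y1) N.
Let A := diag_op A1 B.

Lemma block_products (lam : nat -> R) (p n : nat) (u : hilbert_sum Y1 Y2) :
  (forall k, (k <= p)%nat -> resolvent_set E A (RtoC (lam k))) ->
  Nat.iter n (op_prod (fun k => right_resolvent E A (lam k)) (p + 1)) u =
    (Nat.iter n (op_prod (fun k => right_resolvent (id_bop Y1) A1 (lam k)) (p + 1)) (fst u),
     Nat.iter n (op_prod (fun k => right_resolvent N B (lam k)) (p + 1)) (snd u)) /\
  Nat.iter n (op_prod (fun k => left_resolvent E A (lam k)) (p + 1)) u =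
    (Nat.iter n (op_prod (fun k => left_resolvent (id_bop Y1) A1 (lam k)) (p + 1)) (fst u),
     Nat.iter n (op_prod (fun k => left_resolvent N B (lam k)) (p + 1)) (snd u)).
Proof.
intros H; split; apply iter_pair; apply op_prod_pair; intros i v Hi.
- apply diag_right_resolvent, H; lia.
- apply diag_left_resolvent, H; lia.
Qed.

Lemma block_radial_fst (p n : nat) (w K : R) :
  ray_in_resolvent_set E A w -> radial_estimates E A p w K n ->
  radial_estimates (id_bop Y1) A1 p w K n.
Proof.
intros Hray H lam Hlam bound.
assert (Hres : forall k, (k <= p)%nat -> resolvent_set E A (RtoC (lam k)))
  by (intros; now apply Hray, Hlam).
destruct (H lam Hlam) as [HR HL].
split; apply op_norm_le_iff; intros x Hx.
- assert (HR' := proj1 (op_norm_le_iff _ _ _ _) HR (x, zero)).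
  rewrite (proj1 (block_products lam p n (x, zero) Hres)), norm_inl in HR'.
  apply Rle_trans with (2 := HR' Hx).
  apply (norm_fst_le Y1 Y2 (_, _)).
- assert (HL' := proj1 (op_norm_le_iff _ _ _ _) HL (x, zero)).
  rewrite (proj2 (block_products lam p n (x, zero) Hres)), norm_inl in HL'.
  apply Rle_trans with (2 := HL' Hx).
  apply (norm_fst_le Y1 Y2 (_, _)).
Qed.

Lemma block_ray (k : nat) (w : R) :
  vanishing_power N k -> ray_in_resolvent_set (id_bop Y1) A1 w ->
  ray_in_resolvent_set E A w.
Proof.
intros HN Hray l Hl; apply diag_resolvent_set; split.
- now apply Hray.
- exact (nilpotent_resolvent_set Y2 N k (RtoC l) HN).
Qed.

(* For [n = 0] both sides are identities and the estimate needs [1 <= K]. *)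
Lemma block_radial (p n : nat) (w K : R) :
  vanishing_power N (p + 1) -> ray_in_resolvent_set (id_bop Y1) A1 w ->
  radial_estimates (id_bop Y1) A1 p w K (S n) ->
  radial_estimates E A p w K (S n).
Proof.
intros HN Hray H lam Hlam bound.
assert (Hray' := block_ray _ _ HN Hray).
assert (Hres : forall k, (k <= p)%nat -> resolvent_set E A (RtoC (lam k)))
  by (intros; now apply Hray', Hlam).
assert (HresN : forall k, resolvent_set N B (RtoC (lam k)))
  by (intros; now apply nilpotent_resolvent_set with (1 := HN)).
destruct (H lam Hlam) as [HR HL].
split; apply op_norm_le_iff; intros u Hu;
  assert (Hu1 := Rle_trans _ _ _ (norm_fst_le Y1 Y2 u) Hu).
- rewrite (proj1 (block_products lam p (S n) u Hres)).
  (* The outermost product of [p + 1] factors already annihilates all of [Y2]. *)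
  replace (Nat.iter (S n) _ (snd u)) with (zero : Y2).
  + rewrite norm_inl; exact (proj1 (op_norm_le_iff _ _ _ _) HR (fst u) Hu1).
  + symmetry; apply (op_prod_vanishes Y2 N); [|apply HN].
    intros k i v _; now apply right_resolvent_lowers.
- rewrite (proj2 (block_products lam p (S n) u Hres)).
  replace (Nat.iter (S n) _ (snd u)) with (zero : Y2).
  + rewrite norm_inl; exact (proj1 (op_norm_le_iff _ _ _ _) HL (fst u) Hu1).
  + symmetry; apply (op_prod_vanishes Y2 N); [|apply HN].
    intros k i v _; now apply left_resolvent_lowers.
Qed.

(* On the kernel of [N ^ (p + 2)] the product of the [p + 1] resolvents is
   [N ^ (p + 1)] up to sign, whatever the [lam k] are, whereas the radial bound
   tends to [0] as the [lam k] tend to infinity. *)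
Lemma block_radial_kernel (p : nat) (w K : R) :
  0 < K -> ray_in_resolvent_set E A w -> radial_estimates E A p w K 1 ->
  forall x, Nat.iter (p + 2) N x = zero -> Nat.iter (p + 1) N x = zero.
Proof.
intros HK Hray H.
assert (Hunit : forall x : Y2, norm x <= 1 -> Nat.iter (p + 2) N x = zero ->
  norm (Nat.iter (p + 1) N x) = 0).
{ intros x Hx Hz.
  apply Rle_antisym; [|apply (norm_ge_0 (V := CompleteNormedModule.NormedModule C_AbsRing Y2))].
  apply Rnot_lt_le; intros Hpos.
  set (a := norm (Nat.iter (p + 1) N x)) in *.
  (* [t >= 1] makes the product of the [p + 1] factors [t] at least [t]; the other bound gives
     [K / t <= a / 2], against [a <= K / t]. *)
  pose (t := Rmax 1 (2 * K / a)).
  assert (Ht1 : 1 <= t) by apply Rmax_l.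
  assert (Ht2 : 2 * K / a <= t) by apply Rmax_r.
  assert (Hlam : forall k : nat, (k <= p)%nat -> w < w + t) by (intros; lra).
  assert (Hres : forall k : nat, (k <= p)%nat -> resolvent_set E A (RtoC (w + t)))
    by (intros; apply Hray; lra).
  destruct (H (fun _ => w + t) Hlam) as [HR _].
  assert (HR' := proj1 (op_norm_le_iff _ _ _ _) HR (zero, x)).
  rewrite (proj1 (block_products (fun _ => w + t) p 1 (zero, x) Hres)), norm_inr in HR'.
  specialize (HR' Hx).
  assert (Ha : a <= K / prod_f_R0 (fun _ => Rabs (w + t - w) ^ 1) p).
  { apply Rle_trans with (2 := HR').
    eapply Rle_trans; [|apply (norm_snd_le Y1 Y2 (_, _))].
    right; symmetry.
    apply (norm_op_prod_right_resolvent Y2 N (fun _ => w + t) (p + 1)).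
    - intros k Hk; apply (diag_resolvent_set _ _ _ _ (id_bop Y1) A1), (Hres 0%nat); lia.
    - replace (S (p + 1)) with (p + 2)%nat by lia; exact Hz. }
  assert (Hprod : forall j, t <= prod_f_R0 (fun _ => Rabs (w + t - w) ^ 1) j).
  { replace (w + t - w) with t by ring.
    rewrite pow_1, Rabs_pos_eq by lra.
    induction j as [|j IH]; simpl; [lra|].
    rewrite <- (Rmult_1_r t) at 1; apply Rmult_le_compat; lra. }
  specialize (Hprod p).
  assert (Hinv : K / prod_f_R0 (fun _ => Rabs (w + t - w) ^ 1) p <= K / t).
  { apply Rmult_le_compat_l; [lra|apply Rinv_le_contravar; lra]. }
  assert (HKt : K <= a / 2 * t).
  { apply Rmult_le_compat_l with (r := a / 2) in Ht2; [|lra].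
    replace (a / 2 * (2 * K / a)) with K in Ht2 by (field; lra); exact Ht2. }
  assert (K / t <= a / 2).
  { apply Rmult_le_reg_r with t; [lra|].
    replace (K / t * t) with K by (field; lra); exact HKt. }
  lra. }
intros x Hz.
(* Kernels are invariant under scaling, so the unit ball suffices; the 1 avoids division by zero. *)
pose (c := norm x + 1).
assert (Hn := norm_ge_0 (V := CompleteNormedModule.NormedModule C_AbsRing Y2) x).
assert (Hc : 0 < c) by (unfold c; lra).
assert (Hlin : forall k (a : C) (v : Y2), Nat.iter k N (scal a v) = scal a (Nat.iter k N v)).
{ intros k a v; apply (linear_scal _ (iter_linear Y2 N k (bop_is_linear N))). }
assert (Hx1 : norm (scal (RtoC (/ c)) x) <= 1).
{ rewrite (norm_real_scal Y2), Rabs_pos_eq by (left; now apply Rinv_0_lt_compat).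
  apply Rmult_le_reg_l with c; [exact Hc|].
  rewrite <- Rmult_assoc, Rinv_r by lra; unfold c; lra. }
assert (Hz' : Nat.iter (p + 2) N (scal (RtoC (/ c)) x) = zero).
{ rewrite Hlin, Hz; vector Y2. }
assert (H0 := Hunit _ Hx1 Hz').
apply (norm_eq_zero (V := CompleteNormedModule.NormedModule C_AbsRing Y2)) in H0.
rewrite Hlin in H0.
rewrite <- (real_scal_inv Y2 c (Nat.iter (p + 1) N x)) by lra.
transitivity (scal (RtoC c) (zero : Y2)); [f_equal; exact H0|vector Y2].
Qed.

(** The inclusion of kernels, applied to N^j x, lowers a vanishing exponent p + 2 + j to p + 1 + j;
    nilpotency provides the exponent from which to descend. *)
Lemma block_radial_vanishing (p : nat) (w K : R) :
  nilpotent N -> 0 < K -> ray_in_resolvent_set E A w ->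
  radial_estimates E A p w K 1 -> vanishing_power N (p + 1).
Proof.
intros [k Hk] HK Hray H.
assert (Hker := block_radial_kernel p w K HK Hray H).
assert (Hdown : forall j, vanishing_power N (p + 1 + j) -> vanishing_power N (p + 1)).
{ induction j as [|j IH]; intros Hj; [now rewrite Nat.add_0_r in Hj|].
  apply IH; intros x.
  rewrite Nat.iter_add; apply Hker; rewrite <- Nat.iter_add.
  replace (p + 2 + j)%nat with (p + 1 + S j)%nat by lia; apply Hj. }
apply (Hdown k), vanishing_power_le with k; [lia|exact Hk].
Qed.

End Blocks.

Theorem theorem3p6 (Y1 Y2 : HilbertSpace) (N : BoundedOp Y2 Y2)
  (HN : nilpotent N) (A1 : LinOp Y1 Y1) (HA1 : closed_op A1)
  (HdA1 : densely_defined A1) (p : nat) :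
  let E := diag_bop (id_bop Y1) N in
  let A := diag_op A1 (linop_of_bop (id_bop Y2)) in
  (has_radiality_index E A p <->
     has_radiality_index (id_bop Y1) A1 p /\ nilpotency_degree_le N (p + 1)) /\
  (generates_C0_semigroup A1 -> nilpotency_degree_le N (p + 1) ->
     p_radial E A p /\ has_radiality_index E A p).
Proof.
intros E A; rewrite nilpotency_degree_le_iff; split.
- split.
  + intros [w [K [Hw [HK [Hray Hrad]]]]]; split.
    * exists w, K; do 2 (split; [assumption|]); split.
      -- intros l Hl; apply (diag_resolvent_set _ _ _ _ (id_bop Y1) A1 N
           (linop_of_bop (id_bop Y2))); now apply Hray.
      -- exact (block_radial_fst Y1 Y2 N A1 p 1 w K Hray Hrad).
    * exact (block_radial_vanishing Y1 Y2 N A1 p w K HN HK Hray Hrad).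
  + intros [[w [K [Hw [HK [Hray Hrad]]]]] Hv].
    exists w, K; do 2 (split; [assumption|]); split.
    * now apply block_ray with (p + 1)%nat.
    * now apply block_radial.
- intros Hgen Hv.
  destruct (generator_radial_estimates Y1 A1 HA1 HdA1 Hgen)
    as [w [M [Hw [HM [Hray Hrad]]]]].
  assert (HM0 : 0 < M) by lra.
  assert (Hray' : ray_in_resolvent_set E A w) by now apply block_ray with (p + 1)%nat.
  assert (Hrad' : forall n, radial_estimates E A p w M n).
  (* At exponent 0 the bound is [M] itself, and [1 <= M] covers the identity. *)
  { intros [|n]; [|now apply block_radial].
    intros lam Hlam; simpl.
    assert (H1 : M / prod_f_R0 (fun _ => 1) p = M).
    { rewrite <- (pow_O 0), prod_f_R0_pow, pow_O; field. }
    rewrite H1; split; apply op_norm_le_iff; intros x Hx; exact (Rle_trans _ _ _ Hx HM). }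
  assert (Hidx : has_radiality_index E A p) by (exists w, M; auto).
  split; [|exact Hidx]; split; [exact Hidx|].
  exists w, M; auto.
Qed.
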